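(* Let $G$ be a real or complex semisimple Lie group, $P\subsetneq G$ a parabolic subgroup, and let $(\pi:\mathcal G\to M,\omega)$ be a regular, normal parabolic geometry of type $(G,P)$ with $M$ connected, with symmetry algebra $\widetilde{\mathcal S}=\mathfrak{inf}(\mathcal G,\omega)$ and harmonic curvature $\kappa_H$. Given any $u\in\mathcal G$, the associated graded $\mathfrak s(u)=\mathrm{gr}(\omega_u(\widetilde{\mathcal S}))\subseteq\mathfrak g$ satisfies $$\mathfrak s(u)\subseteq\mathfrak a^{\kappa_H(u)}.$$
   Context: Let $\mathfrak p\subsetneq\mathfrak g$ be the Lie algebras of $P\subsetneq G$. There is a canonical $P$-invariant filtration $\mathfrak g=\mathfrak g^{-\nu}\supset\dots\supset\mathfrak g^{\nu}$ with $\mathfrak g^0=\mathfrak p$, $\mathfrak g^1=\mathfrak p_+$ the nilradical, $[\mathfrak g^i,\mathfrak g^j]\subset\mathfrak g^{i+j}$. Fix a Lie algebra grading $\mathfrak g=\mathfrak g_{-\nu}\oplus\dots\oplus\mathfrak g_\nu$, given by a grading element $\mathsf Z\in\mathfrak z(\mathfrak g_0)$, with $\mathfrak g^i=\bigoplus_{j\ge i}\mathfrak g_j$; $\mathfrak g_-=\bigoplus_{i<0}\mathfrak g_i$ is generated by $\mathfrak g_{-1}$. A parabolic geometry $(\pi:\mathcal G\to M,\omega)$ of type $(G,P)$ is a principal $P$-bundle with a Cartan connection $\omega:T\mathcal G\to\mathfrak g$ (each $\omega_u$ is a linear isomorphism, $R_p^*\omega=\mathrm{Ad}_{p^{-1}}\circ\omega$,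 $\omega$ reproduces generators of fundamental vertical vector fields). Its curvature $K=d\omega+\tfrac12[\omega,\omega]$ gives the curvature function $\kappa:\mathcal G\to\bigwedge^2\mathfrak p_+\otimes\mathfrak g$. Regular: $\kappa(\mathfrak g^i,\mathfrak g^j)\subset\mathfrak g^{i+j+1}$ for $i,j<0$. Normal: $\partial^*\kappa=0$, with $\partial^*$ the Kostant codifferential (up to sign, the homology differential for chains on $\mathfrak p_+$ with values in $\mathfrak g$). Harmonic curvature $\kappa_H=\kappa\bmod\mathrm{im}(\partial^* )$ takes values in the completely reducible $P$-module $\ker(\partial^* )/\mathrm{im}(\partial^* )$ ($\mathfrak p_+$ acts trivially), isomorphic to $H^2(\mathfrak g_-,\mathfrak g)$ as a $\mathfrak g_0$-module; for regular geometries it is valued in $H^2_+(\mathfrak g_-,\mathfrak g)$, the part where $\mathsf Z$ acts with positive eigenvalues. $\mathfrak{inf}(\mathcal G,\omega)=\{\xi\in\mathfrak X(\mathcal G)^P:\mathcal L_\xi\omega=0\}$. The subspace $\omega_u(\widetilde{\mathcal S})=\{\omega_u(\xi_u):\xi\in\widetilde{\mathcal S}\}\subset\mathfrak g$ is filtered by restriction of the filtration of $\mathfrak g$, and its associated graded is viewed as a graded subspace of $\mathfrak g$ via $\mathfrak g^i/\mathfrak g^{i+1}\cong\mathfrak g_i$. For an element $\phi$ of a $\mathfrak g_0$-representation, $\mathfrak a^\phi=\bigoplus_k\mathfrak a_k\subset\mathfrak g$ is the Tanaka prolongation algebra $\mathrm{pr}^{\mathfrak g}(\mathfrak g_-,\mathfrak{ann}(\phi))$: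 $\mathfrak a_k=\mathfrak g_k$ for $k<0$, $\mathfrak a_0=\mathfrak{ann}(\phi)=\{A\in\mathfrak g_0: A\cdot\phi=0\}$, and $\mathfrak a_k=\{X\in\mathfrak g_k:[X,\mathfrak g_{-1}]\subset\mathfrak a_{k-1}\}$ for $k>0$. *)

(* Defs.v *)
From HB Require Import structures.
From mathcomp Require Import all_boot all_order all_algebra complex.
From mathcomp Require Import all_classical all_reals all_analysis.
From mathcomp Require Import ring.

Set Implicit Arguments.
Unset Strict Implicit.
Unset Printing Implicit Defensive.

Import Order.TTheory GRing.Theory Num.Theory.
Import numFieldNormedType.Exports.

Local Open Scope classical_set_scope.
Local Open Scope ring_scope.

(* Everything is developed over a scalar field K, to be instantiated with the
   reals or with R[i].  In the latter case derivatives are complex derivatives,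
   so "smooth" means holomorphic, manifolds and Lie groups are complex
   manifolds and complex Lie groups, and so on. *)

Section SmoothMaps.
Variables (K : numFieldType) (m n : nat).

Fixpoint Ck (k : nat) (U : set 'rV[K]_m) (f : 'rV[K]_m -> 'rV[K]_n) : Prop :=
  match k with
  | 0 => forall x, U x -> {for x, continuous f}
  | k'.+1 => (forall x, U x -> differentiable f x) /\
             (forall v, Ck k' U ('D_v f))
  end.

(* Only meant for open U. *)
Definition smooth_on (U : set 'rV[K]_m) (f : 'rV[K]_m -> 'rV[K]_n) : Prop :=
  forall k, Ck k U f.

End SmoothMaps.

(* The atlas has one chart [chart x] (with inverse [param x]) around each
   point x; charts are total functions, meaningful on [source x] only. *)
Record manifold (K : numFieldType) (n : nat) := Manifold {
  points :> topologicalType;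
  source : points -> set points;
  chart : points -> points -> 'rV[K]_n;
  param : points -> 'rV[K]_n -> points;
  manifold_hausdorff : hausdorff_space points;
  manifold_second_countable : @second_countable points;
  source_center : forall x, source x x;
  source_open : forall x, open (source x);
  image_open : forall x, open (chart x @` source x);
  chartK : forall x y, source x y -> param x (chart x y) = y;
  chart_continuous : forall x y, source x y -> {for y, continuous (chart x)};
  param_continuous : forall x q, (chart x @` source x) q ->
    {for q, continuous (param x)};
  chart_compatible : forall x y,
    smooth_on (chart x @` (source x `&` source y)) (chart y \o param x)
}.

(* As all fibres of the tangent bundle, T_xM is 'rV_n: a tangent vector at x is
   represented by its coordinates in the chart [chart x] centred at x.  In this
   way vector fields on M are functions M -> 'rV_n, and 1-forms with values in V
   are families of linear maps 'rV_n -> V indexed by M. *)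
Section Manifolds.
Variable K : numFieldType.

Definition image_of n (M : manifold K n) (x : M) : set 'rV[K]_n :=
  chart x @` source x.

Definition smooth_map_on m n (M : manifold K m) (N : manifold K n)
    (U : set M) (f : M -> N) : Prop :=
  (forall x, U x -> {for x, continuous f}) /\
  (forall x y, smooth_on (chart x @` (source x `&` U `&` f @^-1` source y))
                         (chart y \o f \o param x)).

Definition smooth_map m n (M : manifold K m) (N : manifold K n) (f : M -> N) :=
  smooth_map_on setT f.

(* Smoothness of a map M1 x M2 -> N, in the product charts. *)
Definition smooth_map2 m1 m2 n (M1 : manifold K m1) (M2 : manifold K m2)
    (N : manifold K n) (f : M1 -> M2 -> N) : Prop :=
  continuous (fun z : M1 * M2 => f z.1 z.2) /\
  forall (x1 : M1) (x2 : M2) (y : N),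
    smooth_on
      [set w : 'rV[K]_(m1 + m2) |
        [/\ image_of x1 (lsubmx w), image_of x2 (rsubmx w) &
            source y (f (param x1 (lsubmx w)) (param x2 (rsubmx w)))]]
      (fun w => chart y (f (param x1 (lsubmx w)) (param x2 (rsubmx w)))).

Definition tangent_map m n (M : manifold K m) (N : manifold K n) (f : M -> N)
    (x : M) (v : 'rV[K]_m) : 'rV[K]_n :=
  'D_v (chart (f x) \o f \o param x) (chart x x).

Section Fields.
Variables (n : nat) (M : manifold K n).

(* Coordinate expression, in the chart centred at x, of a vector field. *)
Definition field_in_chart (x : M) (X : M -> 'rV[K]_n) (q : 'rV[K]_n) :
    'rV[K]_n :=
  let y := param x q in 'D_(X y) (chart x \o param y) (chart y y).

Definition smooth_field (X : M -> 'rV[K]_n) : Prop :=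
  forall x, smooth_on (image_of x) (field_in_chart x X).

Definition field_bracket (X Y : M -> 'rV[K]_n) (x : M) : 'rV[K]_n :=
  'D_(X x) (field_in_chart x Y) (chart x x)
  - 'D_(Y x) (field_in_chart x X) (chart x x).

Variable d : nat.
Implicit Type omega : M -> 'rV[K]_n -> 'rV[K]_d.

(* Coordinate expression, in the chart centred at x, of a 1-form: its value at
   param x q on the vector with coordinates w in that chart. *)
Definition form_in_chart (x : M) omega (q w : 'rV[K]_n) : 'rV[K]_d :=
  let y := param x q in omega y ('D_w (chart y \o param x) q).

Definition smooth_form omega : Prop :=
  forall x w, smooth_on (image_of x) (fun q => form_in_chart x omega q w).

(* dw(V, W) = V.w(W) - W.w(V) - w([V, W]), for the vector fields V and W with
   constant coordinates v and w in the chart centred at x. *)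
Definition ext_deriv omega (x : M) (v w : 'rV[K]_n) : 'rV[K]_d :=
  'D_v (fun q => form_in_chart x omega q w) (chart x x)
  - 'D_w (fun q => form_in_chart x omega q v) (chart x x).

(* (L_X w)(W) = X.w(W) - w([X, W]), for the vector field W with constant
   coordinates w in the chart centred at x, so that [X, W] is minus the
   derivative of (the coordinates of) X along w. *)
Definition lie_deriv_form (X : M -> 'rV[K]_n) omega (x : M) (w : 'rV[K]_n) :
    'rV[K]_d :=
  'D_(X x) (fun q => form_in_chart x omega q w) (chart x x)
  + omega x ('D_w (field_in_chart x X) (chart x x)).

End Fields.
End Manifolds.

Record lie_group (K : numFieldType) (n : nat) := LieGroup {
  group_manifold :> manifold K n;
  gmul : group_manifold -> group_manifold -> group_manifold;
  ginv : group_manifold -> group_manifold;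
  gone : group_manifold;
  gmulA : associative gmul;
  gmul1 : left_id gone gmul;
  gmulV : left_inverse gone ginv gmul;
  gmul_smooth : smooth_map2 gmul;
  ginv_smooth : smooth_map ginv
}.

Record lie_algebra (K : numFieldType) (d : nat) := LieAlgebra {
  br : 'rV[K]_d -> 'rV[K]_d -> 'rV[K]_d;
  br_linearl : forall Y, linear (br^~ Y);
  br_linearr : forall X, linear (br X);
  br_alt : forall X, br X X = 0;
  br_jacobi : forall X Y W, br X (br Y W) + br Y (br W X) + br W (br X Y) = 0
}.

Section LieGroups.
Variables (K : numFieldType) (d : nat) (G : lie_group K d).

Definition left_invariant_field (A : 'rV[K]_d) (g : G) : 'rV[K]_d :=
  tangent_map (gmul g) (gone G) A.

(* The Lie algebra of G is T_eG, i.e. 'rV_d, with the bracket coming from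
   left-invariant vector fields. *)
Definition is_lie_algebra_of (L : lie_algebra K d) : Prop :=
  forall A B, br L A B =
    field_bracket (left_invariant_field A) (left_invariant_field B) (gone G).

Definition Ad (g : G) (A : 'rV[K]_d) : 'rV[K]_d :=
  tangent_map (fun h => gmul (gmul g h) (ginv g)) (gone G) A.

End LieGroups.

Section GradedAlgebra.
Variables (K : numFieldType) (d : nat) (L : lie_algebra K d).
Local Notation g := 'rV[K]_d.

Definition ad (X : g) : 'M[K]_d := lin1_mx (br L X).

Definition killing (X Y : g) : K := \tr (ad X *m ad Y).

(* Semisimplicity as in Helgason, Ch. II, par. 6: nondegenerate Killing form. *)
Definition semisimple : Prop :=
  forall X, (forall Y, killing X Y = 0) -> X = 0.

Definition is_subalgebra (h : set g) : Prop :=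
  [/\ h 0, forall a X Y, h X -> h Y -> h (a *: X + Y) &
      forall X Y, h X -> h Y -> h (br L X Y)].

Variables (Z : g) (nu : nat).

(* g_j *)
Definition grade (j : int) : set g := [set X | (br L Z X) = j%:~R *: X].

(* The sum of the subspaces a_j, for -nu <= j <= nu. *)
Definition graded_sum (a : int -> set g) : set g :=
  [set X | exists x : 'I_(nu.*2.+1) -> g,
     (forall k : 'I_(nu.*2.+1), a ((k : nat)%:Z - nu%:Z) (x k)) /\ X = \sum_k x k].

(* g^i *)
Definition filt (i : int) : set g :=
  graded_sum (fun j => if i <= j then grade j else [set 0]).

(* The eigenspaces of ad Z are independent, and with eigenvalues adding up under
   the bracket; moreover Z lies in g_0 and commutes with g_0. *)
Record is_grading_element : Prop := IsGradingElement {
  grading_full : graded_sum grade = setT;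
  grading_generated : forall h, is_subalgebra h -> grade (-1) `<=` h ->
    forall j : int, j < 0 -> grade j `<=` h
}.

(* Degree j component of the associated graded of a subspace V of g, filtered by
   the V /\ g^j: the image of V /\ g^j in g^j / g^(j+1) = g_j. *)
Definition gr_component (V : set g) (j : int) : set g :=
  [set X | grade j X /\
     exists Y, [/\ V Y, filt j Y & filt (j + 1) (Y - X)]].

Definition gr (V : set g) : set g := graded_sum (gr_component V).

Fixpoint tanaka_nonneg (a0 : set g) (k : nat) : set g :=
  match k with
  | 0 => a0
  | k'.+1 => [set X | grade k'.+1%:Z X /\
                forall Y, grade (-1) Y -> tanaka_nonneg a0 k' (br L X Y)]
  end.

Definition tanaka_component (a0 : set g) (k : int) : set g :=
  match k with
  | Posz n => tanaka_nonneg a0 n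
  | Negz _ => grade k
  end.

(* pr^g(g_-, a0), for a0 in g_0 *)
Definition tanaka (a0 : set g) : set g := graded_sum (tanaka_component a0).

(* Elements of /\^k g (x) g are alternating k-tensors with coefficients in g,
   with respect to the standard basis (e_i) of g. *)
Definition tensor1 := {ffun 'I_d -> g}.
Definition tensor2 := {ffun 'I_d * 'I_d -> g}.
Definition tensor3 := {ffun 'I_d * 'I_d * 'I_d -> g}.

Definition pure1 (X v : g) : tensor1 := [ffun i => X 0 i *: v].

(* (X /\ Y) (x) v *)
Definition wedge2 (X Y v : g) : tensor2 :=
  [ffun ij => (X 0 ij.1 * Y 0 ij.2 - Y 0 ij.1 * X 0 ij.2) *: v].

(* (X /\ Y /\ W) (x) v *)
Definition wedge3 (X Y W v : g) : tensor3 :=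
  [ffun ijk => let: (i, j, k) := ijk in
     (X 0 i * Y 0 j * W 0 k + Y 0 i * W 0 j * X 0 k + W 0 i * X 0 j * Y 0 k
      - Y 0 i * X 0 j * W 0 k - X 0 i * W 0 j * Y 0 k - W 0 i * Y 0 j * X 0 k)
     *: v].

Local Notation pplus := (filt 1).

(* /\^2 p_+ (x) g *)
Definition chains2 : set tensor2 :=
  [set T | exists (n : nat) (X Y v : 'I_n -> g),
     (forall k, pplus (X k) /\ pplus (Y k)) /\
     T = \sum_k wedge2 (X k) (Y k) (v k)].

(* /\^3 p_+ (x) g *)
Definition chains3 : set tensor3 :=
  [set T | exists (n : nat) (X Y W v : 'I_n -> g),
     (forall k, [/\ pplus (X k), pplus (Y k) & pplus (W k)]) /\
     T = \sum_k wedge3 (X k) (Y k) (W k) (v k)].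

(* An element of /\^2 p_+ (x) g as a 2-form on g / p = (p_+)^*, the duality
   being given by the Killing form. *)
Definition form_of_chain (T : tensor2) (X Y : g) : g :=
  \sum_i \sum_j
    (killing (delta_mx 0 i) X * killing (delta_mx 0 j) Y) *: T (i, j).

(* The Kostant codifferential in degrees 2 and 3: the Lie algebra homology
   differential, see codiff2_wedge and codiff3_wedge below. *)
Definition codiff2 (T : tensor2) : tensor1 :=
  [ffun a => \sum_j (br L (delta_mx 0 j) (T (a, j)))
     - 2^-1 *: \sum_i \sum_j (br L (delta_mx 0 i) (delta_mx 0 j)) 0 a *: T (i, j)].

Definition codiff3 (T : tensor3) : tensor2 :=
  let U a b :=
    \sum_i \sum_j (br L (delta_mx 0 i) (delta_mx 0 j)) 0 a *: T (i, j, b) in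
  [ffun ab => - \sum_k (br L (delta_mx 0 k) (T (ab.1, ab.2, k)))
     - 2^-1 *: (U ab.1 ab.2 - U ab.2 ab.1)].

(* Tensor product of (co)adjoint actions, see act2_wedge below. *)
Definition act2 (A : g) (T : tensor2) : tensor2 :=
  [ffun ij => (br L A (T ij))
     + \sum_k ((br L A (delta_mx 0 k)) 0 ij.1 *: T (k, ij.2)
               + (br L A (delta_mx 0 k)) 0 ij.2 *: T (ij.1, k))].

(* The image of the codifferential in /\^2 p_+ (x) g. *)
Definition boundaries : set tensor2 := codiff3 @` chains3.

(* The class of T modulo the image of the codifferential; elements of the
   quotient are represented by cosets. *)
Definition homology_class (T : tensor2) : set tensor2 :=
  [set S | boundaries (S - T)].

Definition act_class (A : g) (c : set tensor2) : set tensor2 :=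
  [set S | exists2 T, c T & homology_class (act2 A T) S].

Definition ann (c : set tensor2) : set g :=
  [set A | grade 0 A /\ act_class A c = homology_class 0].

End GradedAlgebra.

Section DecomposableChains.
Variables (K : numFieldType) (d : nat) (L : lie_algebra K d).
Local Notation g := 'rV[K]_d.

Let brDl (X1 X2 Y : g) : br L (X1 + X2) Y = br L X1 Y + br L X2 Y.
Proof. by have := br_linearl L Y 1 X1 X2; rewrite !scale1r. Qed.

Let brDr (X Y1 Y2 : g) : br L X (Y1 + Y2) = br L X Y1 + br L X Y2.
Proof. by have := br_linearr L X 1 Y1 Y2; rewrite !scale1r. Qed.

Let br0l (Y : g) : br L 0 Y = 0.
Proof. by apply: (addrI (br L 0 Y)); rewrite -brDl !addr0. Qed.

Let br0r (X : g) : br L X 0 = 0.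
Proof. by apply: (addrI (br L X 0)); rewrite -brDr !addr0. Qed.

Let brZl a (X Y : g) : br L (a *: X) Y = a *: br L X Y.
Proof. by have := br_linearl L Y a X 0; rewrite br0l !addr0. Qed.

Let brZr a (X Y : g) : br L X (a *: Y) = a *: br L X Y.
Proof. by have := br_linearr L X a Y 0; rewrite br0r !addr0. Qed.

Let br_suml I (r : seq I) (F : I -> g) (Y : g) :
  br L (\sum_(i <- r) F i) Y = \sum_(i <- r) br L (F i) Y.
Proof.
apply: (big_morph (br L ^~ Y)) => [X1 X2|]; first exact: brDl.
exact: br0l.
Qed.

Let br_sumr I (r : seq I) (F : I -> g) (X : g) :
  br L X (\sum_(i <- r) F i) = \sum_(i <- r) br L X (F i).
Proof.
apply: (big_morph (br L X)) => [Y1 Y2|]; first exact: brDr.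
exact: br0r.
Qed.

Let br_basisl (X v : g) : \sum_j X 0 j *: br L (delta_mx 0 j) v = br L X v.
Proof.
rewrite [in RHS](row_sum_delta X) br_suml.
by apply: eq_bigr => j _; rewrite brZl.
Qed.

Let br_basisr (A X : g) : \sum_j X 0 j *: br L A (delta_mx 0 j) = br L A X.
Proof.
rewrite [in RHS](row_sum_delta X) br_sumr.
by apply: eq_bigr => j _; rewrite brZr.
Qed.

Let coord_basis (X Y : g) a : \sum_i \sum_j
  br L (delta_mx 0 i) (delta_mx 0 j) 0 a * (X 0 i * Y 0 j) = br L X Y 0 a.
Proof.
rewrite -(br_basisl X Y) summxE; apply: eq_bigr => i _.
rewrite mxE -(br_basisr _ Y) summxE mulr_sumr; apply: eq_bigr => j _.
by rewrite mxE mulrC mulrA.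
Qed.

Let coord_basisA (A X : g) a :
  \sum_k br L A (delta_mx 0 k) 0 a * X 0 k = br L A X 0 a.
Proof.
rewrite -(br_basisr A X) summxE; apply: eq_bigr => k _.
by rewrite mxE mulrC.
Qed.

Let br_alternate (X Y : g) : br L Y X = - br L X Y.
Proof.
apply/eqP; rewrite -addr_eq0; apply/eqP.
by have := br_alt L (X + Y); rewrite brDl !brDr !br_alt addr0 add0r addrC.
Qed.

Lemma codiff2_wedge (X Y v : g) :
  codiff2 L (wedge2 X Y v) =
  pure1 X (br L Y v) - pure1 Y (br L X v) - pure1 (br L X Y) v.
Proof.
apply/ffunP => a; rewrite !ffunE; congr (_ + - _).
  rewrite -[br L Y v]br_basisl -[br L X v]br_basisl !scaler_sumr -sumrB.
  by apply: eq_bigr => j _; rewrite ffunE brZr scalerBl !scalerA.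
have -> : \sum_i \sum_j br L (delta_mx 0 i) (delta_mx 0 j) 0 a *:
    wedge2 X Y v (i, j) = (2 * br L X Y 0 a) *: v.
  under eq_bigr do under eq_bigr do rewrite ffunE scalerA mulrBr /=.
  under eq_bigr do rewrite -scaler_suml sumrB.
  rewrite -scaler_suml sumrB !coord_basis [br L Y X]br_alternate mxE opprK.
  by rewrite mulr_natl.
by rewrite scalerA mulrA mulVf ?mul1r ?pnatr_eq0.
Qed.

Lemma codiff3_wedge (X Y W v : g) :
  codiff3 L (wedge3 X Y W v) =
  - wedge2 Y W (br L X v) + wedge2 X W (br L Y v) - wedge2 X Y (br L W v)
  - wedge2 (br L X Y) W v + wedge2 (br L X W) Y v - wedge2 (br L Y W) X v.
Proof.
apply/ffunP => -[a b]; rewrite !ffunE /=.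
pose U a b := (2 * (br L X Y 0 a * W 0 b + br L Y W 0 a * X 0 b
                    - br L X W 0 a * Y 0 b)) *: v.
have HU a' b' : \sum_i \sum_j br L (delta_mx 0 i) (delta_mx 0 j) 0 a' *:
    wedge3 X Y W v (i, j, b') = U a' b'.
  under eq_bigr do under eq_bigr do rewrite ffunE scalerA /=.
  under eq_bigr do rewrite -scaler_suml.
  rewrite -scaler_suml /U; congr (_ *: _).
  have E (P Q S : g) : \sum_i \sum_j br L (delta_mx 0 i) (delta_mx 0 j) 0 a' *
      (P 0 i * Q 0 j * S 0 b') = br L P Q 0 a' * S 0 b'.
    rewrite -coord_basis mulr_suml; apply: eq_bigr => i _; rewrite mulr_suml.
    by apply: eq_bigr => j _; rewrite !mulrA.
  under eq_bigr do under eq_bigr do rewrite !mulrBr !mulrDr.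
  under eq_bigr do rewrite !sumrB !big_split.
  rewrite !sumrB !big_split /= !E.
  rewrite [br L Y X]br_alternate [br L W X]br_alternate [br L W Y]br_alternate.
  by rewrite !mxE; ring.
have -> : \sum_k br L (delta_mx 0 k) (wedge3 X Y W v (a, b, k)) =
    (X 0 a * Y 0 b - Y 0 a * X 0 b) *: br L W v
  + (Y 0 a * W 0 b - W 0 a * Y 0 b) *: br L X v
  + (W 0 a * X 0 b - X 0 a * W 0 b) *: br L Y v.
  rewrite -!br_basisl !scaler_sumr -!big_split; apply: eq_bigr => k _ /=.
  rewrite ffunE brZr !scalerA -!scalerDl; congr (_ *: _); ring.
by rewrite !HU /U; apply/rowP => c; rewrite !mxE; field; rewrite ?pnatr_eq0.
Qed.

Lemma act2_wedge (A X Y v : g) :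
  act2 L A (wedge2 X Y v) =
  wedge2 (br L A X) Y v + wedge2 X (br L A Y) v + wedge2 X Y (br L A v).
Proof.
apply/ffunP => -[a b]; rewrite !ffunE /= brZr addrC; congr (_ + _).
rewrite big_split /=.
have -> : \sum_k br L A (delta_mx 0 k) 0 a *: wedge2 X Y v (k, b) =
    (br L A X 0 a * Y 0 b - br L A Y 0 a * X 0 b) *: v.
  rewrite -!coord_basisA !mulr_suml -sumrB scaler_suml; apply: eq_bigr => k _.
  by rewrite ffunE /= scalerA; congr (_ *: _); ring.
have -> : \sum_k br L A (delta_mx 0 k) 0 b *: wedge2 X Y v (a, k) =
    (br L A Y 0 b * X 0 a - br L A X 0 b * Y 0 a) *: v.
  rewrite -!coord_basisA !mulr_suml -sumrB scaler_suml; apply: eq_bigr => k _.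
  by rewrite ffunE /= scalerA; congr (_ *: _); ring.
by rewrite -!scalerDl; congr (_ *: _); ring.
Qed.

(* form_of_chain identifies Z1 /\ Z2 (x) v with the 2-form
   (X, Y) |-> (B(Z1, X) B(Z2, Y) - B(Z2, X) B(Z1, Y)) v. *)
Lemma form_of_wedge (Z1 Z2 v X Y : g) :
  form_of_chain L (wedge2 Z1 Z2 v) X Y =
  (killing L Z1 X * killing L Z2 Y - killing L Z2 X * killing L Z1 Y) *: v.
Proof.
have B (P Q : g) : killing L P Q =
    \sum_i P 0 i * killing L (delta_mx 0 i) Q.
  rewrite /killing.
  have -> : ad L P = \sum_i P 0 i *: ad L (delta_mx 0 i).
    apply/matrixP => r c; rewrite summxE mxE -br_basisl summxE.
    by apply: eq_bigr => i _; rewrite !mxE.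
  rewrite mulmx_suml raddf_sum; apply: eq_bigr => i _ /=.
  by rewrite -scalemxAl mxtraceZ.
rewrite /form_of_chain (B Z1 X) (B Z2 Y) (B Z2 X) (B Z1 Y).
rewrite !big_distrlr /= -sumrB scaler_suml; apply: eq_bigr => i _.
rewrite -sumrB scaler_suml; apply: eq_bigr => j _.
by rewrite ffunE /= scalerA; congr (_ *: _); ring.
Qed.

End DecomposableChains.

Section ParabolicGeometry.
Variables (K : numFieldType) (d p m N : nat).
Variables (G : lie_group K d) (L : lie_algebra K d) (Z : 'rV[K]_d) (nu : nat).
Variables (P : lie_group K p) (iota : P -> G).

(* P is a closed Lie subgroup of G, via the inclusion iota, with Lie algebra
   the parabolic subalgebra g^0.  Such a subgroup normalizes g^0, hence lies
   between the normalizer of g^0 in G and its identity component. *)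
Record is_parabolic_subgroup : Prop := IsParabolicSubgroup {
  subgroup_smooth : smooth_map iota;
  subgroup_inj : injective iota;
  subgroup_mul : forall a b, iota (gmul a b) = gmul (iota a) (iota b);
  subgroup_closed : closed (range iota);
  subgroup_immersion : injective (tangent_map iota (gone P));
  subgroup_lie_algebra : range (tangent_map iota (gone P)) = filt L Z nu 0
}.

Variables (M : manifold K m) (T : manifold K N).
Variables (pi : T -> M) (act : T -> P -> T).

Record is_principal_bundle : Prop := IsPrincipalBundle {
  projection_smooth : smooth_map pi;
  action_smooth : smooth_map2 act;
  action_one : forall u, act u (gone P) = u;
  action_mul : forall u a b, act (act u a) b = act u (gmul a b);
  action_fibre : forall u a, pi (act u a) = pi u;
  (* s is a local section, and (y, a) |-> s(y) a a diffeomorphism from U x P to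
     the preimage of U, with inverse u |-> (pi(u), t(u)) *)
  local_triviality : forall x, exists (U : set M) (s : M -> T) (t : T -> P),
    [/\ open U, U x, smooth_map_on U s, smooth_map_on (pi @^-1` U) t &
     [/\ forall y, U y -> pi (s y) = y,
         forall u, U (pi u) -> act (s (pi u)) (t u) = u &
         forall y a, U y -> t (act (s y) a) = a]]
}.

Variable omega : T -> {linear 'rV[K]_N -> 'rV[K]_d}.

Record is_cartan_connection : Prop := IsCartanConnection {
  cartan_smooth : smooth_form (fun u => omega u : 'rV[K]_N -> 'rV[K]_d);
  cartan_iso : forall u, bijective (omega u);
  cartan_equivariant : forall u a v,
    omega (act u a) (tangent_map (act^~ a) u v) =
    Ad (ginv (iota a)) (omega u v);
  (* The fundamental vector field of A at u is the image of A under the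
     differential of a |-> u a at the identity. *)
  cartan_fundamental : forall u A,
    omega u (tangent_map (act u) (gone P) A) = tangent_map iota (gone P) A
}.

(* K = d omega + 1/2 [omega, omega] *)
Definition curvature (u : T) (v w : 'rV[K]_N) : 'rV[K]_d :=
  ext_deriv (fun u => omega u : 'rV[K]_N -> 'rV[K]_d) u v w
  + br L (omega u v) (omega u w).

(* kappa : T -> /\^2 p_+ (x) g is K, read through omega and the identification
   of 2-forms on g / p with elements of /\^2 p_+. *)
Definition is_curvature_function (kappa : T -> tensor2 K d) : Prop :=
  forall u, chains2 L Z nu (kappa u) /\
    forall v w, form_of_chain L (kappa u) (omega u v) (omega u w)
                = curvature u v w.

Definition is_regular (kappa : T -> tensor2 K d) : Prop :=
  forall u (i j : int), i < 0 -> j < 0 -> forall X Y,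
    filt L Z nu i X -> filt L Z nu j Y ->
    filt L Z nu (i + j + 1) (form_of_chain L (kappa u) X Y).

Definition is_normal (kappa : T -> tensor2 K d) : Prop :=
  forall u, codiff2 L (kappa u) = 0.

Definition harmonic_curvature (kappa : T -> tensor2 K d) (u : T) :
    set (tensor2 K d) :=
  homology_class L Z nu (kappa u).

Definition infinitesimal_symmetries : set (T -> 'rV[K]_N) :=
  [set xi | [/\ smooth_field xi,
     forall u a, xi (act u a) = tangent_map (act^~ a) u (xi u) &
     forall u w, lie_deriv_form xi
       (fun u => omega u : 'rV[K]_N -> 'rV[K]_d) u w = 0]].

Definition symmetries_at (u : T) : set 'rV[K]_d :=
  [set omega u (xi u) | xi in infinitesimal_symmetries].

End ParabolicGeometry.

(* Main.v *)
From HB Require Import structures.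
Require Import Defs.
From mathcomp Require Import all_boot all_order all_algebra complex.
From mathcomp Require Import all_classical all_reals all_analysis.
From mathcomp Require Import ring lra.

Set Implicit Arguments.
Unset Strict Implicit.
Unset Printing Implicit Defensive.

Import Order.TTheory GRing.Theory Num.Theory.
Import numFieldNormedType.Exports.

Local Open Scope classical_set_scope.
Local Open Scope ring_scope.

(** Let D_A, for A in g, be the vector field with omega (D_A) = A, and let
    these fields act on functions, in the chart centred at the given point u.

    - The structure equation reads [D_A, D_B] = D_C with C the function
      [A, B] - kappa (A, B) ([along_commutator]).  The Jacobi identity of these
      fields is the Bianchi identity ([bianchi]).  For A in p, since kappa is
      horizontal, it says that D_A kappa = - A . kappa ([along_form]), which is
      the equivariance of the curvature function under P.
    - The formula of Cartan A . T = - d* (A /\ T) - A /\ d* T ([cartan_wedge])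
      shows that p_+ acts trivially on ker d* / im d*.  Hence, if H is the
      composite of kappa with a linear functional vanishing on im d*, then
      D_A H = 0 for A in p_+, while for A in p the value D_A H (u) is minus this
      functional at A . kappa (u) ([along_harmonic_coord]).
    - A symmetry xi commutes with all D_A ([symmetry_commutes]), and therefore
      annihilates kappa and H ([symmetry_torsion], [symmetry_harmonic_coord]).

    Let X = omega_u (xi_u) be in g^k and let Y1, ..., Yk be in g_{-1}.  By the
    last point xi annihilates D_Y1 ... D_Yk H, and at u this says that
    D_X D_Y1 ... D_Yk H (u) = 0, where now X stands for a constant.  Move D_X to
    the right by means of [D_Z, D_Y] = D_[Z, Y], valid for Z in p.  In all terms
    but one, some D_Z with Z in p_+ ends up next to H, so that these terms
    vanish on the whole chart ([iter_along_vanish]).  The remaining term is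
    D_A H (u) for A = [..[[X, Y1], Y2].., Yk], which lies in g^0.  As H was
    arbitrary, A . kappa (u) is in im d*.  Since p_+ acts trivially on
    homology, the component of A in g_0, which is the iterated bracket of the
    component of X in g_k, annihilates kappa_H (u) as well.  For all Y1, ..., Yk
    together, this says that the component of X in g_k is in the prolongation
    ([tanaka_of_iterates]).

    The analysis takes place over the reals and over the complex numbers at
    once: the only fact that depends on the field is the equality of mixed
    partial derivatives ([mixed_partials]). *)

(** * Equality of mixed partial derivatives *)

Section RealMixedPartials.
Variable R : realType.

Lemma mean_value_from0 (f df : R -> R) (r : R) : 0 < r ->
  (forall x : R, 0 <= x <= r -> is_derive x (1 : R) f (df x)) ->
  exists2 c, 0 < c < r & f r - f 0 = r * df c.
Proof.
move=> r0 fd.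
have [||c] := @MVT R f df 0 r r0.
- move=> x; rewrite in_itv /= => /andP[x0 xr].
  by apply: fd; rewrite !ltW.
- apply: derivable_within_continuous => x; rewrite in_itv /= => xr.
  by have [] := fd x xr.
rewrite in_itv /= subr0 => cr ->; exists c => //; exact: mulrC.
Qed.

(** Two uses of the mean value theorem, first in s and then in t.  Exchanging
    the roles of s and t yields the other mixed derivative from the same second
    difference, whence the equality of the two in the limit r -> 0. *)
Lemma second_difference (g gs gst : R -> R -> R) (r : R) : 0 < r ->
  (forall s t : R, 0 <= s <= r -> 0 <= t <= r -> is_derive s (1 : R) (g^~ t) (gs s t)) ->
  (forall s t : R, 0 <= s <= r -> 0 <= t <= r -> is_derive t (1 : R) (gs s) (gst s t)) ->
  exists s t, [/\ 0 < s < r, 0 < t < r &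
    g r r - g r 0 - (g 0 r - g 0 0) = r * (r * gst s t)].
Proof.
move=> r0 gsP gstP.
have rr : 0 <= r <= r by rewrite lexx ltW.
have r00 : 0 <= (0 : R) <= r by rewrite lexx ltW.
have [|s sr e1] := @mean_value_from0 (fun s => g s r - g s 0)
    (fun s => gs s r - gs s 0) r r0.
  by move=> s sr; apply: is_deriveB; exact: gsP.
have sr' : 0 <= s <= r by case/andP: sr => *; rewrite !ltW.
have [|t tr e2] := @mean_value_from0 (gs s) (gst s) r r0.
  by move=> t tr; exact: gstP.
by exists s, t; split => //; rewrite e1 e2.
Qed.

Lemma real_mixed_partials (g gs gt gst gts : R -> R -> R) (e : R) : 0 < e ->
  (forall s t : R, `|s| < e -> `|t| < e ->
    [/\ is_derive s (1 : R) (g^~ t) (gs s t), is_derive t (1 : R) (g s) (gt s t),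
        is_derive t (1 : R) (gs s) (gst s t) & is_derive s (1 : R) (gt^~ t) (gts s t)]) ->
  (forall eta, 0 < eta -> exists2 del, 0 < del &
    forall s t : R, `|s| < del -> `|t| < del ->
      `|gst s t - gst 0 0| < eta /\ `|gts s t - gts 0 0| < eta) ->
  gst 0 0 = gts 0 0.
Proof.
move=> e0 gP gc; apply/eqP; rewrite -subr_eq0 -normr_le0.
apply/ler_addgt0Pr => eta eta0; rewrite add0r.
have [|del del0 near0] := gc (eta / 2); first by rewrite divr_gt0.
pose r := Num.min e del / 2.
have m0 : 0 < Num.min e del by rewrite lt_min e0.
have r0 : 0 < r by rewrite divr_gt0.
have [re rd] : r < e /\ r < del.
  by apply/andP; rewrite -lt_min /r; lra.
have inr s : 0 <= s <= r -> `|s| < e /\ `|s| < del.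
  by case/andP=> s0 sr; rewrite ger0_norm //; split; apply: le_lt_trans sr _.
have [s [t [sr tr E1]]] : exists s t, [/\ 0 < s < r, 0 < t < r &
    g r r - g r 0 - (g 0 r - g 0 0) = r * (r * gst s t)].
  apply: (@second_difference g gs gst r) => // s t /inr[s1 _] /inr[t1 _];
    by case: (gP s t s1 t1).
have [t' [s' [tr' sr' E2]]] : exists s t, [/\ 0 < s < r, 0 < t < r &
    g r r - g 0 r - (g r 0 - g 0 0) = r * (r * gts t s)].
  apply: (@second_difference (fun t s => g s t) (fun t s => gt s t)
    (fun t s => gts s t) r) => // t' s' /inr[t1 _] /inr[s1 _];
    by case: (gP s' t' s1 t1).
have E : gst s t = gts s' t'.
  apply: (mulfI (lt0r_neq0 r0)); apply: (mulfI (lt0r_neq0 r0)).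
  by rewrite -E1 -E2; ring.
have W x : 0 < x < r -> `|x| < del.
  by case/andP=> *; case: (inr x) => //; rewrite !ltW.
have [L1 _] := near0 s t (W _ sr) (W _ tr).
have [_ L2] := near0 s' t' (W _ sr') (W _ tr').
have -> : gst 0 0 - gts 0 0 = (gts s' t' - gts 0 0) - (gst s t - gst 0 0).
  by rewrite E; ring.
by apply: le_trans (ler_normB _ _) _; lra.
Qed.

End RealMixedPartials.

(** The two cases K = R and K = R[i] are treated together by means of an
    embedding iota of the reals and of a real-linear coordinate rho : K -> R.
    For K = R[i] this is applied to the real and to the imaginary part; the
    complex directional derivatives of h restrict to real derivatives of
    rho o h on the real plane through x spanned by v and w. *)
Section RestrictionToReals.
Variables (R : realType) (K : numFieldType).
Variables (iota : {rmorphism R -> K}) (rho : {additive K -> R}).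
Hypothesis iota_norm : forall r, `|iota r| = iota `|r|.
Hypothesis rho_iota : forall r k, rho (iota r * k) = r * rho k.
Hypothesis rho_norm : forall k, iota `|rho k| <= `|k|.
Hypothesis iota_pos : forall k : K, 0 <= k -> exists r, iota r = k.

Lemma iota_ge0 r : (0 <= iota r) = (0 <= r).
Proof.
apply/idP/idP => [h|h]; last by rewrite -(ger0_norm h) -iota_norm.
have : iota `|r| = iota r by rewrite -iota_norm ger0_norm.
by move/fmorph_inj => <-.
Qed.

Lemma iota_le r s : (iota r <= iota s) = (r <= s).
Proof. by rewrite -subr_ge0 -rmorphB iota_ge0 subr_ge0. Qed.

Lemma iota_lt r s : (iota r < iota s) = (r < s).
Proof. by rewrite !lt_neqAle iota_le (inj_eq (fmorph_inj _)). Qed.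

Lemma iota_gt0 r : (0 < iota r) = (0 < r).
Proof. by rewrite -iota_lt rmorph0. Qed.

Lemma iota_below (k : K) : 0 < k -> exists2 r, 0 < r & iota r = k.
Proof.
move=> k0; have [r rk] := iota_pos (ltW k0); exists r => //.
by rewrite -iota_gt0 rk.
Qed.

Lemma rho_continuous : continuous rho.
Proof.
move=> k A /nbhs_ballP[e /= e0 eA]; apply/nbhs_ballP.
exists (iota e); rewrite /= ?iota_gt0 // => y; rewrite -ball_normE /= => yk.
apply: eA; rewrite -ball_normE /= -iota_lt; apply: le_lt_trans yk.
by rewrite -raddfB; exact: rho_norm.
Qed.

Lemma iota_dnbhs0 : iota @ 0^' --> 0^'.
Proof.
move=> A [e e0 eA]; have [r r0 re] := iota_below e0.
exists r => //= t; rewrite /= sub0r normrN => tr t0; apply: eA => /=.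
  by rewrite sub0r normrN iota_norm -re iota_lt.
by rewrite fmorph_eq0.
Qed.

Lemma is_derive_restrict (V : normedModType K) (h : V -> K) (a v : V) (s : R) :
  derivable h (a + iota s *: v) v ->
  is_derive s 1 (fun r => rho (h (a + iota r *: v)))
                (rho ('D_v h (a + iota s *: v))).
Proof.
set b := a + _ => hd.
pose q (k : K) := k^-1 *: ((h \o shift b) (k *: v) - h b).
have qc : (q \o iota) @ 0^' --> 'D_v h b := cvg_comp _ _ iota_dnbhs0 hd.
have C := cvg_comp _ _ qc (@rho_continuous ('D_v h b)).
have E : (fun t : R => t^-1 *: (((fun r => rho (h (a + iota r *: v))) \o
      shift s) (t *: (1 : R)) - rho (h b))) = rho \o (q \o iota).
  apply/funext => t /=; rewrite /q /= -fmorphV rho_iota (raddfB rho) /=.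
  by rewrite [t *: 1]mulr1 rmorphD scalerDl addrCA.
rewrite -E in C.
by split; [apply/cvg_ex; exists (rho ('D_v h b)) | apply: cvg_lim C].
Qed.

Variables (V : normedModType K) (x v w : V).

Definition real_plane s t := x + iota s *: v + iota t *: w.

Lemma real_plane_near (A : set V) : nbhs x A ->
  exists2 e, 0 < e & forall s t, `|s| < e -> `|t| < e -> A (real_plane s t).
Proof.
move=> /nbhs_ballP[e /= e0 eA].
have n0 : 0 < `|v| + `|w| + 1 by rewrite ltr_wpDl ?addr_ge0.
have [r r0 re] := iota_below (divr_gt0 e0 n0).
exists r => // s t sr tr; apply: eA; rewrite -ball_normE /= distrC /real_plane.
rewrite -(addrA x) (addrC x) addrK; apply: le_lt_trans (ler_normD _ _) _.
rewrite !normrZ !iota_norm.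
apply: (@le_lt_trans _ _ (iota r * `|v| + iota r * `|w|)).
  by rewrite lerD // ler_wpM2r // iota_le ltW.
rewrite -mulrDr re -[ltRHS](divfK (lt0r_neq0 n0)) ltr_pM2l ?divr_gt0 //.
by rewrite ltrDl ltr01.
Qed.

Lemma mixed_partials_restricted (h : V -> K) (O : set V) : open O -> O x ->
  (forall y, O y -> [/\ derivable h y v, derivable h y w,
     derivable ('D_v h) y w & derivable ('D_w h) y v]) ->
  {for x, continuous ('D_w ('D_v h))} -> {for x, continuous ('D_v ('D_w h))} ->
  rho ('D_w ('D_v h) x) = rho ('D_v ('D_w h) x).
Proof.
move=> oO Ox hd cwv cvw.
have [e e0 eO] := real_plane_near (open_nbhs_nbhs (conj oO Ox)).
pose on_plane (f : V -> K) s t := rho (f (real_plane s t)).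
have p00 : real_plane 0 0 = x by rewrite /real_plane !rmorph0 !scale0r !addr0.
have swap s t : real_plane s t = x + iota t *: w + iota s *: v.
  by rewrite /real_plane addrAC.
have Dv (f : V -> K) s t : derivable f (real_plane s t) v ->
    is_derive s (1 : R) ((on_plane f)^~ t) (on_plane ('D_v f) s t).
  rewrite /on_plane => fd.
  under eq_fun do rewrite swap.
  by rewrite swap in fd *; exact: is_derive_restrict.
have Dw (f : V -> K) s t : derivable f (real_plane s t) w ->
    is_derive t (1 : R) (on_plane f s) (on_plane ('D_w f) s t).
  exact: is_derive_restrict.
have cont (f : V -> K) : {for x, continuous f} -> forall eta, 0 < eta ->
    exists2 del, 0 < del & forall s t, `|s| < del -> `|t| < del ->
      `|on_plane f s t - on_plane f 0 0| < eta.
  move=> fc eta eta0.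
  have : nbhs x [set y | `|rho (f x) - rho (f y)| < eta].
    have /cvgrPdist_lt/(_ _ eta0) : (rho \o f) y @[y --> x] --> rho (f x).
      exact: (cvg_comp _ _ fc (@rho_continuous (f x))).
    exact.
  move=> /real_plane_near[del del0 H]; exists del => // s t sd td.
  by rewrite distrC /on_plane p00; exact: H.
have := @real_mixed_partials R (on_plane h) (on_plane ('D_v h))
  (on_plane ('D_w h)) (on_plane ('D_w ('D_v h))) (on_plane ('D_v ('D_w h)))
  e e0; rewrite /on_plane p00; apply.
  move=> s t se te; case: (hd _ (eO _ _ se te)) => ? ? ? ?.
  by split; [apply: Dv|apply: Dw|apply: Dw|apply: Dv].
move=> eta eta0; have [d1 d10 H1] := cont _ cwv _ eta0.
have [d2 d20 H2] := cont _ cvw _ eta0.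
exists (Num.min d1 d2); first by rewrite lt_min d10.
move=> s t; rewrite !lt_min => /andP[s1 s2] /andP[t1 t2].
by have := conj (H1 _ _ s1 t1) (H2 _ _ s2 t2); rewrite /on_plane p00.
Qed.

End RestrictionToReals.

Lemma mixed_partials (R : realType) (K : numFieldType)
    (hK : K = R :> numFieldType \/ K = R[i] :> numFieldType)
    (V : normedModType K) (h : V -> K) (O : set V) (x v w : V) :
  open O -> O x ->
  (forall y, O y -> [/\ derivable h y v, derivable h y w,
     derivable ('D_v h) y w & derivable ('D_w h) y v]) ->
  {for x, continuous ('D_w ('D_v h))} -> {for x, continuous ('D_v ('D_w h))} ->
  'D_w ('D_v h) x = 'D_v ('D_w h) x.
Proof.
case: hK => eK; subst K => oO Ox hd c1 c2.
  apply: (@mixed_partials_restricted R R idfun idfun _ _ _ _ V x v w h O) => //.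
  by move=> k k0; exists k.
have normC (k : R[i]) :
    `|k| = (Num.sqrt (complex.Re k ^+ 2 + complex.Im k ^+ 2))%:C%C.
  by case: k.
apply/eqP; rewrite eq_complex; apply/andP; split; apply/eqP.
- apply: (@mixed_partials_restricted R R[i] (real_complex R) (@complex.Re R) _ _ _ _
    V x v w h O) => //.
  + by move=> r; rewrite normC /= expr0n addr0 sqrtr_sqr.
  + by move=> r [a b]; rewrite /= mul0r subr0.
  + move=> k; rewrite normC lecR -sqrtr_sqr ler_wsqrtr // lerDl.
    exact: sqr_ge0.
  + move=> [a b]; rewrite lecE /= => /andP[/eqP -> _]; by exists a.
- apply: (@mixed_partials_restricted R R[i] (real_complex R) (@complex.Im R) _ _ _ _
    V x v w h O) => //.
  + by move=> r; rewrite normC /= expr0n addr0 sqrtr_sqr.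
  + by move=> r [a b]; rewrite /= mul0r addr0.
  + move=> k; rewrite normC lecR -sqrtr_sqr ler_wsqrtr // lerDr.
    exact: sqr_ge0.
  + move=> [a b]; rewrite lecE /= => /andP[/eqP -> _]; by exists a.
Qed.

(** * Smooth functions on an open set *)

Section Locality.
Variables (K : numFieldType) (V W : normedModType K) (O : set V) (oO : open O).

Lemma near_open (P : V -> Prop) x :
  O x -> (forall y, O y -> P y) -> \forall y \near x, P y.
Proof.
move=> Ox OP; have : nbhs x O by apply: open_nbhs_nbhs.
by apply: filterS => y /OP.
Qed.

Lemma derive_eq_on (f g : V -> W) x v : O x -> (forall y, O y -> f y = g y) ->
  'D_v f x = 'D_v g x.
Proof. by move=> Ox fg; apply: near_eq_derive; exact: near_open. Qed.

(** The differential depends on the germ of the function only: the expansion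
    of f at x is also one for g, and differentials are unique. *)
Lemma differentiable_eq_on (f g : V -> W) x : O x ->
  (forall y, O y -> f y = g y) -> differentiable f x -> differentiable g x.
Proof.
move=> Ox fg fd; have fg' := fg; have [fc fE] := (diff_locallyP x f).1 fd.
have gE : g \o shift x = cst (g x) + 'd f x +o_ 0 id.
  apply/eqaddoP => e e0; have /eqaddoP/(_ e e0) := fE.
  have : \forall y \near x, f y = g y by exact: near_open.
  rewrite (near_shift 0) subr0 => fg0; apply: filterS2 fg0 => h /= {}fg.
  rewrite -[(_ - _) h]/(f (h + x) - (f x + 'd f x h)).
  rewrite -[X in _ -> is_true (`|X| <= _)]/(g (h + x) - (g x + 'd f x h)).
  by rewrite fg (fg' _ Ox).
apply/diff_locallyP; have -> : 'd g x = 'd f x :> (V -> W).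
  exact: diff_unique.
by split.
Qed.

End Locality.

Section Coordinates.
Variables (K : numFieldType) (V : normedModType K).

Lemma derive_lin_comb n (W : normedModType K) (f : 'rV[K]_n -> W) x v :
  differentiable f x ->
  'D_v f x = \sum_j v 0 j *: 'D_(delta_mx 0 j) f x.
Proof.
move=> fd; rewrite deriveE // [in LHS](row_sum_delta v) linear_sum.
by apply: eq_bigr => j _; rewrite linearZ /= deriveE.
Qed.

Lemma coord_differentiable m n (f : V -> 'M[K]_(m, n)) x i j :
  differentiable f x -> differentiable (fun y => f y i j) x.
Proof.
move=> fd; exact: (differentiable_comp fd (differentiable_coord _ i j)).
Qed.

Lemma derive_coord m n (f : V -> 'M[K]_(m, n)) x v i j : differentiable f x ->
  'D_v (fun y => f y i j) x = ('D_v f x) i j.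
Proof.
move=> fd; have cd := differentiable_coord (f x) i j.
rewrite deriveE; last exact: coord_differentiable.
rewrite (diff_comp fd cd) /= deriveE //.
have @c : {linear 'M[K]_(m, n) -> K}.
  by exists (fun N : 'M[K]_(_, _) => N i j); do 2![eexists]; do ?[constructor];
     rewrite ?mxE// => ? *; rewrite ?mxE//; move=> ?; rewrite !mxE.
rewrite (_ : (fun N : 'M[K]_(m, n) => N i j) = c) //.
by rewrite diff_lin //; exact: coord_continuous.
Qed.

Lemma derive_comp_vec n (W : normedModType K) (phi : V -> 'rV[K]_n)
    (f : 'rV[K]_n -> W) x v :
  differentiable phi x -> differentiable f (phi x) ->
  'D_v (f \o phi) x = 'D_('D_v phi x) f (phi x).
Proof.
move=> pd fd; rewrite !deriveE //; last exact: differentiable_comp.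
by rewrite diff_comp.
Qed.

End Coordinates.

Section SmoothFunctions.
Variables (K : numFieldType) (V : normedModType K) (O : set V).
Hypothesis oO : open O.

(** If this holds for all k, then all iterated derivatives are differentiable,
    and therefore continuous. *)
Fixpoint times_diff k (h : V -> K) : Prop :=
  match k with
  | 0 => True
  | k'.+1 => (forall x, O x -> differentiable h x) /\
             forall v, times_diff k' ('D_v h)
  end.

Definition smooth h := forall k, times_diff k h.

Lemma times_diff_eq k h g : (forall x, O x -> h x = g x) ->
  times_diff k h -> times_diff k g.
Proof.
elim: k h g => // k IH h g hg /= [hd hD]; split.
  by move=> x Ox; exact: (differentiable_eq_on oO Ox hg (hd x Ox)).
move=> v; apply: IH (hD v) => x Ox.
exact: (derive_eq_on oO v Ox hg).
Qed.

Lemma times_diffS k h : times_diff k.+1 h -> times_diff k h.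
Proof.
elim: k h => // k IH h [hd hD]; split => // v; exact: IH (hD v).
Qed.

Lemma times_diffD k h g :
  times_diff k h -> times_diff k g -> times_diff k (h + g).
Proof.
elim: k h g => // k IH h g [hd hD] [gd gD]; split.
  by move=> x Ox; apply: differentiableD; [exact: hd|exact: gd].
move=> v; apply: times_diff_eq (IH _ _ (hD v) (gD v)) => x Ox.
by rewrite deriveD //; apply: diff_derivable; [exact: hd|exact: gd].
Qed.

Lemma times_diffM k h g :
  times_diff k h -> times_diff k g -> times_diff k (h * g).
Proof.
elim: k h g => // k IH h g hk gk.
have [hd hD] := hk; have [gd gD] := gk; split.
  by move=> x Ox; apply: differentiableM; [exact: hd|exact: gd].
move=> v.
have := times_diffD (IH _ _ (times_diffS hk) (gD v))
                    (IH _ _ (times_diffS gk) (hD v)).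
apply: times_diff_eq => x Ox.
by rewrite deriveM //; apply: diff_derivable; [exact: hd|exact: gd].
Qed.

Lemma times_diff_cst k c : times_diff k (cst c).
Proof.
elim: k c => // k IH c; split=> [x _|v]; first exact: differentiable_cst.
by apply: times_diff_eq (IH 0) => x Ox; rewrite derive_cst.
Qed.

Lemma times_diffV k h : (forall x, O x -> h x != 0) ->
  times_diff k h -> times_diff k (fun x => (h x)^-1).
Proof.
move=> h0; elim: k => // k IH hk; have [hd hD] := hk.
have Vk := IH (times_diffS hk); split.
  by move=> x Ox; apply: differentiableV; [exact: hd|exact: h0].
move=> v.
have := times_diffM (times_diff_cst k (-1))
  (times_diffM (times_diffM Vk Vk) (hD v)).
apply: times_diff_eq => x Ox.
rewrite deriveV; [|exact: h0|by apply: diff_derivable; exact: hd].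
rewrite -[LHS]/(-1 * (((h x)^-1 * (h x)^-1) * 'D_v h x)) -[RHS]/(_ * _).
by rewrite expr2 invfM mulN1r mulNr.
Qed.

Lemma smooth_eq h g : (forall x, O x -> h x = g x) -> smooth h -> smooth g.
Proof. by move=> hg hs k; exact: times_diff_eq (hs k). Qed.

Lemma smooth_cst c : smooth (fun=> c).
Proof. by move=> k; exact: times_diff_cst. Qed.

Lemma smoothD h g : smooth h -> smooth g -> smooth (fun x => h x + g x).
Proof. by move=> hs gs k; exact: times_diffD. Qed.

Lemma smoothM h g : smooth h -> smooth g -> smooth (fun x => h x * g x).
Proof. by move=> hs gs k; exact: times_diffM. Qed.

Lemma smoothV h : (forall x, O x -> h x != 0) -> smooth h ->
  smooth (fun x => (h x)^-1).
Proof. by move=> h0 hs k; exact: times_diffV. Qed.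

Lemma smooth_derive h v : smooth h -> smooth ('D_v h).
Proof. by move=> hs k; have [_] := hs k.+1; apply. Qed.

Lemma smooth_diff h x : smooth h -> O x -> differentiable h x.
Proof. by move=> hs Ox; have [hd _] := hs 1%N; exact: hd. Qed.

Lemma smooth_derivable h x v : smooth h -> O x -> derivable h x v.
Proof. by move=> hs Ox; apply: diff_derivable; exact: smooth_diff. Qed.

Lemma smoothN h : smooth h -> smooth (fun x => - h x).
Proof.
move=> hs; apply: smooth_eq (smoothM (smooth_cst (-1)) hs) => x _ /=.
by rewrite mulN1r.
Qed.

Lemma smoothB h g : smooth h -> smooth g -> smooth (fun x => h x - g x).
Proof. by move=> hs gs; apply: smoothD => //; exact: smoothN. Qed.

Lemma smooth_sum I (r : seq I) (P : pred I) (F : I -> V -> K) :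
  (forall i, smooth (F i)) -> smooth (fun x => \sum_(i <- r | P i) F i x).
Proof.
move=> Fs; elim: r => [|i r IH].
  by apply: smooth_eq (smooth_cst 0) => x _; rewrite big_nil.
case Pi : (P i); last by apply: smooth_eq IH => x _; rewrite big_cons Pi.
by apply: smooth_eq (smoothD (Fs i) IH) => x _; rewrite big_cons Pi.
Qed.

Lemma smooth_prod I (r : seq I) (P : pred I) (F : I -> V -> K) :
  (forall i, smooth (F i)) -> smooth (fun x => \prod_(i <- r | P i) F i x).
Proof.
move=> Fs; elim: r => [|i r IH].
  by apply: smooth_eq (smooth_cst 1) => x _; rewrite big_nil.
case Pi : (P i); last by apply: smooth_eq IH => x _; rewrite big_cons Pi.
by apply: smooth_eq (smoothM (Fs i) IH) => x _; rewrite big_cons Pi.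
Qed.

Definition smooth_mx m n (F : V -> 'M[K]_(m, n)) :=
  forall i j, smooth (fun x => F x i j).

Lemma smooth_det n (F : V -> 'M[K]_n) :
  smooth_mx F -> smooth (fun x => \det (F x)).
Proof.
move=> Fs; apply: smooth_sum => s.
by apply: smoothM; [exact: smooth_cst|apply: smooth_prod => i; exact: Fs].
Qed.

(** By the formula of Cramer, entries of the inverse are polynomials in the
    entries and in the inverse of the determinant. *)
Lemma smooth_invmx n (F : V -> 'M[K]_n) :
  (forall x, O x -> F x \in unitmx) -> smooth_mx F ->
  smooth_mx (fun x => invmx (F x)).
Proof.
move=> Fu Fs i j.
have ds : smooth (fun x => (\det (F x))^-1).
  apply: smoothV; last exact: smooth_det.
  by move=> x /Fu; rewrite unitmxE unitfE.
have cs : smooth (fun x => cofactor (F x) j i).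
  apply: smoothM; first exact: smooth_cst.
  by apply: smooth_det => k l; apply: smooth_eq (Fs _ _) => x _; rewrite !mxE.
apply: smooth_eq (smoothM ds cs) => x Ox.
by rewrite /invmx Fu // !mxE.
Qed.

Lemma smooth_mulmx m n p (F : V -> 'M[K]_(m, n)) (G : V -> 'M[K]_(n, p)) :
  smooth_mx F -> smooth_mx G -> smooth_mx (fun x => F x *m G x).
Proof.
move=> Fs Gs i j.
have : smooth (fun x => \sum_k F x i k * G x k j).
  by apply: smooth_sum => k; exact: smoothM.
by apply: smooth_eq => x _; rewrite mxE.
Qed.

Lemma smooth_cst_mx m n (A : 'M[K]_(m, n)) : smooth_mx (fun=> A).
Proof. by move=> i j; exact: smooth_cst. Qed.

Lemma smooth_schwarz (R : realType)
    (hK : K = R :> numFieldType \/ K = R[i] :> numFieldType)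
    h x v w : smooth h -> O x -> 'D_w ('D_v h) x = 'D_v ('D_w h) x.
Proof.
move=> hs Ox; apply: (mixed_partials hK oO Ox).
- by move=> y Oy; split; apply: smooth_derivable => //; exact: smooth_derive.
- by apply/differentiable_continuous/smooth_diff => //; do 2!apply: smooth_derive.
- by apply/differentiable_continuous/smooth_diff => //; do 2!apply: smooth_derive.
Qed.

End SmoothFunctions.

Arguments smooth_derivable {K V O h x} v _ _.

Lemma smooth_on_coord (K : numFieldType) m n (U : set 'rV[K]_m)
    (f : 'rV[K]_m -> 'rV[K]_n) (j : 'I_n) :
  open U -> smooth_on U f -> smooth U (fun q => f q 0 j).
Proof.
move=> oU fs k; have := fs k; elim: k f {fs} => // k IH f [fd fD].
split=> [x Ux|v]; first by apply: coord_differentiable; exact: fd.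
apply: (times_diff_eq oU) (IH _ (fD v)) => x Ux /=.
by rewrite derive_coord //; exact: fd.
Qed.

Lemma smooth_on_diff (K : numFieldType) m n (U : set 'rV[K]_m)
    (f : 'rV[K]_m -> 'rV[K]_n) x : smooth_on U f -> U x -> differentiable f x.
Proof. by move=> fs Ux; have [fd _] := fs 1%N; exact: fd. Qed.

(** * Frames: structure equation, Bianchi identity, symmetries *)

(** The derivative of h along the field whose coframe components, the coframe
    being W, are the constants A.  Sealed, lest conversion unfold directional
    derivatives to limits. *)
HB.lock Definition frame_derivative (K : numFieldType) (n : nat)
    (W : 'rV[K]_n -> 'M[K]_n) (A : 'rV[K]_n) (h : 'rV[K]_n -> K) (q : 'rV[K]_n) : K :=
  'D_(A *m invmx (W q)) h q.

Section Coframe.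
Variables (R : realType) (K : numFieldType).
Hypothesis hK : K = R :> numFieldType \/ K = R[i] :> numFieldType.
Variables (n : nat) (O : set 'rV[K]_n).
Hypothesis oO : open O.
Local Notation g := 'rV[K]_n.
Local Notation smooth := (smooth O).
Variable W : g -> 'M[K]_n.
Hypothesis W_unit : forall q, O q -> W q \in unitmx.
Hypothesis W_smooth : smooth_mx O W.

Definition frame (A : g) (q : g) : g := A *m invmx (W q).

Local Notation along := (frame_derivative W).

Lemma alongE A h q : along A h q = 'D_(frame A q) h q.
Proof. by rewrite frame_derivative.unlock. Qed.

Definition along_field (F : g -> g) (h : g -> K) (q : g) : K := along (F q) h q.

Definition along_vec (A : g) (F : g -> g) (q : g) : g :=
  \row_c along A (fun y => F y 0 c) q.

(** Minus the exterior derivative of the coframe, on the frame fields of A and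
    B.  This is the C for which [D_A, D_B] = D_C, and for a Cartan connection
    it is [A, B] - kappa (A, B). *)
Definition torsion (A B : g) (q : g) : g :=
  \row_c (\sum_j frame A q 0 j * along B (fun y => W y j c) q
        - \sum_j frame B q 0 j * along A (fun y => W y j c) q).

Lemma frameK A q : O q -> frame A q *m W q = A.
Proof. by move=> Oq; rewrite /frame -mulmxA mulVmx ?mulmx1 ?W_unit. Qed.

Lemma along_eq A h k q : O q -> (forall y, O y -> h y = k y) ->
  along A h q = along A k q.
Proof. by move=> Oq hk; rewrite !alongE; exact: (derive_eq_on oO _ Oq hk). Qed.

Lemma along_cst A c q : along A (fun=> c) q = 0.
Proof. by rewrite alongE derive_cst. Qed.

Lemma alongD A h k q : smooth h -> smooth k -> O q ->
  along A (fun y => h y + k y) q = along A h q + along A k q.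
Proof.
move=> hs ks Oq; rewrite !alongE; exact: (deriveD (smooth_derivable (frame A q) hs Oq)
  (smooth_derivable (frame A q) ks Oq)).
Qed.

Lemma alongM A h k q : smooth h -> smooth k -> O q ->
  along A (fun y => h y * k y) q = along A h q * k q + h q * along A k q.
Proof.
move=> hs ks Oq; rewrite !alongE.
have /= := @deriveM _ _ h k q (frame A q) (smooth_derivable _ hs Oq)
  (smooth_derivable _ ks Oq).
by rewrite addrC [k q *: _]mulrC => <-.
Qed.

Lemma alongN A h q : smooth h -> O q ->
  along A (fun y => - h y) q = - along A h q.
Proof. by move=> hs Oq; rewrite !alongE; exact: (deriveN (smooth_derivable (frame A q) hs Oq)). Qed.

Lemma alongB A h k q : smooth h -> smooth k -> O q ->
  along A (fun y => h y - k y) q = along A h q - along A k q.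
Proof. by move=> hs ks Oq; rewrite alongD ?alongN //; exact: smoothN. Qed.

Lemma along_sum A I (r : seq I) (F : I -> g -> K) q :
  (forall i, smooth (F i)) -> O q ->
  along A (fun y => \sum_(i <- r) F i y) q = \sum_(i <- r) along A (F i) q.
Proof.
move=> Fs Oq; elim: r => [|i r IH].
  by under [X in along _ X]eq_fun do rewrite big_nil; rewrite along_cst big_nil.
under [X in along _ X]eq_fun do rewrite big_cons.
by rewrite alongD ?big_cons ?IH //; exact: smooth_sum.
Qed.

Lemma along_comb A h q : smooth h -> O q ->
  along A h q = \sum_c A 0 c * along (delta_mx 0 c) h q.
Proof.
move=> hs Oq; have hd := smooth_diff hs Oq; rewrite alongE deriveE //.
rewrite /frame [in LHS](row_sum_delta A) mulmx_suml linear_sum.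
apply: eq_bigr => c _; rewrite -scalemxAl linearZ /=.
by rewrite alongE deriveE.
Qed.

Lemma along_linear a A B h q : smooth h -> O q ->
  along (a *: A + B) h q = a * along A h q + along B h q.
Proof.
move=> hs Oq; rewrite !(along_comb _ hs Oq) mulr_sumr -big_split.
by apply: eq_bigr => c _; rewrite !mxE mulrDl mulrA.
Qed.

Lemma smooth_frame A : smooth_mx O (frame A).
Proof.
apply: smooth_mulmx => //; first exact: smooth_cst_mx.
exact: smooth_invmx.
Qed.

Lemma along_partial A h q : smooth h -> O q ->
  along A h q = \sum_j frame A q 0 j * 'D_(delta_mx 0 j) h q.
Proof. by move=> hs Oq; rewrite alongE derive_lin_comb //; exact: smooth_diff Oq. Qed.

Lemma smooth_along A h : smooth h -> smooth (along A h).
Proof.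
move=> hs; have : smooth (fun q => \sum_j frame A q 0 j * 'D_(delta_mx 0 j) h q).
  apply: smooth_sum => // j; apply: smoothM => //; first exact: smooth_frame.
  exact: smooth_derive.
by apply: smooth_eq => // q Oq; rewrite along_partial.
Qed.

Lemma smooth_along_field F h : smooth_mx O F -> smooth h ->
  smooth (along_field F h).
Proof.
move=> Fs hs.
have : smooth (fun q => \sum_c F q 0 c * along (delta_mx 0 c) h q).
  apply: smooth_sum => // c; apply: smoothM => //; exact: smooth_along.
by apply: smooth_eq => // q Oq; rewrite /along_field -along_comb.
Qed.

Lemma smooth_torsion A B : smooth_mx O (torsion A B).
Proof.
move=> i c; pose t A B j q := frame A q 0 j * along B (fun y => W y j c) q.
have ts A' B' j : smooth (t A' B' j).
  by apply: smoothM => //; [exact: smooth_frame|exact: smooth_along].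
have : smooth (fun q => \sum_j t A B j q - \sum_j t B A j q).
  by apply: smoothB => //; exact: smooth_sum.
by apply: smooth_eq => // q Oq; rewrite mxE.
Qed.

(** Differentiate along A the identity saying that frame B pairs with W to
    the constant B, and antisymmetrize. *)
Lemma frame_torsion A B q j : O q ->
  along A (fun y => frame B y 0 j) q - along B (fun y => frame A y 0 j) q =
  frame (torsion A B q) q 0 j.
Proof.
move=> Oq; pose F : g :=
  \row_j (along A (fun y => frame B y 0 j) q - along B (fun y => frame A y 0 j) q).
have leib X Y c : \sum_j along X (fun y => frame Y y 0 j) q * W q j c =
    - \sum_j frame Y q 0 j * along X (fun y => W y j c) q.
  apply/eqP; rewrite -addr_eq0 -big_split /=; apply/eqP.
  have E : along X (fun y => \sum_j frame Y y 0 j * W y j c) q = 0.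
    apply: etrans (along_cst X (Y 0 c) q); apply: along_eq => // y Oy.
    by rewrite -[in RHS](frameK Y Oy) mxE.
  rewrite -[RHS]E along_sum //.
    by apply: eq_bigr => k _; rewrite alongM //; exact: smooth_frame.
  by move=> k; apply: smoothM => //; exact: smooth_frame.
have FW : F *m W q = torsion A B q.
  apply/rowP => c; rewrite !mxE; under eq_bigr do rewrite mxE mulrBl.
  by rewrite sumrB !leib opprK addrC.
by rewrite -FW /frame -mulmxA mulmxV ?W_unit // mulmx1 mxE.
Qed.

(** The second order terms cancel by the equality of mixed partials, and the
    first order ones are those of [frame_torsion]. *)
Lemma along_commutator A B h q : smooth h -> O q ->
  along A (along B h) q - along B (along A h) q = along (torsion A B q) h q.
Proof.
move=> hs Oq.
pose d j := 'D_(delta_mx 0 j : g) h.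
have ds j : smooth (d j) by exact: smooth_derive.
pose second X Y := \sum_j \sum_k
  frame Y q 0 j * frame X q 0 k * 'D_(delta_mx 0 k) (d j) q.
have secondC X Y : second X Y = second Y X.
  rewrite /second exchange_big /=; apply: eq_bigr => k _; apply: eq_bigr => j _.
  apply: (congr2 *%R); first exact: mulrC.
  exact: (@smooth_schwarz _ _ _ oO _ hK h q (delta_mx 0 j) (delta_mx 0 k) hs Oq).
have step X Y : along X (along Y h) q =
    \sum_j along X (fun y => frame Y y 0 j) q * d j q + second X Y.
  rewrite (along_eq X Oq (fun y Oy => along_partial Y hs Oy)) along_sum //.
    rewrite -big_split; apply: eq_bigr => j _.
    rewrite (alongM _ (smooth_frame Y 0 j) (ds j) Oq).
    congr (_ + _); rewrite along_partial // mulr_sumr.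
    by apply: eq_bigr => k _; rewrite mulrA.
  by move=> j; exact: (smoothM oO (smooth_frame Y 0 j) (ds j)).
rewrite (step A B) (step B A) (secondC B A) opprD addrACA subrr addr0.
rewrite -sumrB along_partial //.
by apply: eq_bigr => j _; rewrite -mulrBl frame_torsion.
Qed.

Lemma frame_comb A q j :
  frame A q 0 j = \sum_c A 0 c * frame (delta_mx 0 c) q 0 j.
Proof.
rewrite /frame [in LHS](row_sum_delta A) mulmx_suml summxE.
by apply: eq_bigr => c _; rewrite -scalemxAl mxE.
Qed.

Lemma torsion_comb A F q : O q ->
  torsion A F q = \sum_c F 0 c *: torsion A (delta_mx 0 c) q.
Proof.
move=> Oq; apply/rowP => k; rewrite summxE.
under eq_bigr do rewrite !mxE mulrBr !mulr_sumr.
rewrite sumrB mxE; congr (_ - _); rewrite exchange_big /=; apply: eq_bigr => j _.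
  under eq_bigr do rewrite mulrCA.
  rewrite -mulr_sumr; congr (_ * _).
  exact: (along_comb F (W_smooth j k) Oq).
rewrite frame_comb mulr_suml; apply: eq_bigr => c _.
by rewrite mulrA.
Qed.

Lemma along_addl A B h q : smooth h -> O q ->
  along (A + B) h q = along A h q + along B h q.
Proof. by move=> hs Oq; rewrite -[A]scale1r along_linear // mul1r scale1r. Qed.

(** The coordinate functions suffice. *)
Lemma frame_separates F q : O q -> (forall h, smooth h -> along F h q = 0) ->
  F = 0.
Proof.
move=> Oq F0; rewrite -(frameK F Oq).
suff -> : frame F q = 0 by rewrite mul0mx.
apply/rowP => j; rewrite [RHS]mxE.
have coord_diff x : differentiable (fun y : g => y 0 j) x.
  exact: differentiable_coord.
have D (v x : g) : 'D_v (fun y : g => y 0 j) x = v 0 j.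
  by rewrite (@derive_coord _ _ _ _ id) ?derive_id.
rewrite -(D (frame F q) q) -alongE; apply: F0 => -[|k] //; split => // v.
apply: (times_diff_eq oO) (times_diff_cst oO k (v 0 j)) => x _.
by rewrite D.
Qed.

Lemma along_vecE A F q c :
  along_vec A F q 0 c = along A (fun y => F y 0 c) q.
Proof. by rewrite mxE. Qed.

Lemma along_field_commutator A F h q : smooth_mx O F -> smooth h -> O q ->
  along A (along_field F h) q - along (F q) (along A h) q =
  along (along_vec A F q + torsion A (F q) q) h q.
Proof.
move=> Fs hs Oq.
have E : along A (along_field F h) q =
    \sum_c (along A (fun y => F y 0 c) q * along (delta_mx 0 c) h q
           + F q 0 c * along A (along (delta_mx 0 c) h) q).
  rewrite (along_eq A Oq (fun y Oy => along_comb (F y) hs Oy)) along_sum //.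
    by apply: eq_bigr => c _; rewrite alongM //; exact: smooth_along.
  by move=> c; apply: smoothM => //; exact: smooth_along.
rewrite E big_split /= along_addl // -addrA; congr (_ + _).
  by rewrite [RHS]along_comb //; apply: eq_bigr => c _; rewrite along_vecE.
rewrite (along_comb (F q) (smooth_along A hs) Oq) -sumrB.
rewrite torsion_comb // [RHS]along_comb //.
under [RHS]eq_bigr do rewrite summxE mulr_suml.
rewrite exchange_big /=; apply: eq_bigr => c _.
rewrite -mulrBr along_commutator // along_comb // mulr_sumr.
by apply: eq_bigr => k _; rewrite mulrA; congr (_ * _); rewrite [RHS]mxE.
Qed.

(** The Jacobi identity of D_A, D_B and D_C, applied to functions. *)
Lemma bianchi A B C q : O q ->
    along_vec A (torsion B C) q + torsion A (torsion B C q) q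
  + (along_vec B (torsion C A) q + torsion B (torsion C A q) q)
  + (along_vec C (torsion A B) q + torsion C (torsion A B q) q) = 0.
Proof.
move=> Oq; apply: (frame_separates Oq) => h hs.
have as2 X Y : smooth (along X (along Y h)).
  by apply: smooth_along; exact: smooth_along.
have E X Y U : along (along_vec X (torsion Y U) q + torsion X (torsion Y U q) q) h q =
    along X (along Y (along U h)) q - along X (along U (along Y h)) q
    - (along Y (along U (along X h)) q - along U (along Y (along X h)) q).
  have E1 := along_field_commutator X (smooth_torsion Y U) hs Oq.
  have E2 : along X (along_field (torsion Y U) h) q =
      along X (along Y (along U h)) q - along X (along U (along Y h)) q.
    apply: etrans (alongB X (as2 Y U) (as2 U Y) Oq).
    by apply: along_eq => // y Oy; rewrite along_commutator.
  have E3 := along_commutator Y U (smooth_along X hs) Oq.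
  by rewrite -E1 E2 -E3.
have add3 F1 F2 F3 : along (F1 + F2 + F3) h q =
    along F1 h q + along F2 h q + along F3 h q by rewrite !along_addl.
have jacobi (abc acb bca cba bac cab : K) :
    abc - acb - (bca - cba) + (bca - bac - (cab - acb))
    + (cab - cba - (abc - bac)) = 0 by ring.
apply: etrans (add3 _ _ _) _; apply: etrans (jacobi _ _ _ _ _ _).
exact: (congr2 +%R (congr2 +%R (E A B C) (E B C A)) (E C A B)).
Qed.

(** A field xi is given by the function f = omega (xi), and L_xi omega = 0 says
    that the derivative of f along D_A is - torsion A f. *)
Variable f : g -> g.
Hypothesis f_smooth : smooth_mx O f.
Hypothesis f_sym : forall A q, O q -> along_vec A f q = - torsion A (f q) q.

Lemma symmetry_commutes A h q : smooth h -> O q ->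
  along (f q) (along A h) q = along A (along_field f h) q.
Proof.
move=> hs Oq; apply/esym/eqP; rewrite -subr_eq0.
rewrite along_field_commutator // f_sym // addNr.
by rewrite along_comb //; apply/eqP; rewrite big1 // => c _; rewrite mxE mul0r.
Qed.

(** Since xi commutes with D_A and D_B, it commutes with their commutator,
    which is a combination of the D_c with coefficients torsion A B; so these
    coefficients are annihilated by xi. *)
Lemma symmetry_torsion A B q : O q -> along_vec (f q) (torsion A B) q = 0.
Proof.
move=> Oq; apply: (frame_separates Oq) => h hs.
have fs := smooth_along_field f_smooth hs.
have as1 X : smooth (along X h) by exact: smooth_along.
have c2 X Y : along (f q) (along X (along Y h)) q =
    along X (along Y (along_field f h)) q.
  apply: etrans (symmetry_commutes X (as1 Y) Oq) _; apply: along_eq => // y Oy.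
  exact: (symmetry_commutes Y hs Oy).
have E1 : along (f q) (along_field (torsion A B) h) q =
    along (torsion A B q) (along_field f h) q.
  apply: etrans (along_commutator A B fs Oq).
  apply: etrans (congr2 (fun x y => x - y) (c2 A B) (c2 B A)).
  apply: etrans (alongB _ (smooth_along A (as1 B)) (smooth_along B (as1 A)) Oq).
  by apply: along_eq => // y Oy; apply: esym; exact: along_commutator.
have E2 : along (f q) (along_field (torsion A B) h) q =
    \sum_c (along (f q) (fun y => torsion A B y 0 c) q * along (delta_mx 0 c) h q
           + torsion A B q 0 c * along (f q) (along (delta_mx 0 c) h) q).
  rewrite (along_eq (f q) Oq (fun y Oy => along_comb (torsion A B y) hs Oy)).
  rewrite along_sum //.
    apply: eq_bigr => c _; rewrite alongM //; exact: smooth_torsion.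
  by move=> c; apply: smoothM => //; exact: smooth_torsion.
have := E2; rewrite E1 big_split /= => E.
rewrite along_comb //; under eq_bigr do rewrite along_vecE.
apply: (addIr (\sum_c torsion A B q 0 c * along (f q) (along (delta_mx 0 c) h) q)).
rewrite -E add0r (along_comb (torsion A B q)) //.
by apply: eq_bigr => c _; rewrite symmetry_commutes.
Qed.

End Coframe.

(** * Graded Lie algebras *)

Section LieAlgebra.
Variables (K : numFieldType) (d : nat) (L : lie_algebra K d).
Local Notation g := 'rV[K]_d.
Local Notation "{[ X , Y ]}" := (br L X Y) (at level 0, X, Y at level 99).

Lemma brDl (X Y V : g) : {[X + Y, V]} = {[X, V]} + {[Y, V]}.
Proof. by have := br_linearl L V 1 X Y; rewrite !scale1r. Qed.

Lemma brDr (X Y V : g) : {[X, Y + V]} = {[X, Y]} + {[X, V]}.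
Proof. by have := br_linearr L X 1 Y V; rewrite !scale1r. Qed.

Lemma br0l (Y : g) : {[0, Y]} = 0.
Proof. by apply: (addrI {[0, Y]}); rewrite -brDl !addr0. Qed.

Lemma br0r (X : g) : {[X, 0]} = 0.
Proof. by apply: (addrI {[X, 0]}); rewrite -brDr !addr0. Qed.

Lemma brZl a (X Y : g) : {[a *: X, Y]} = a *: {[X, Y]}.
Proof. by have := br_linearl L Y a X 0; rewrite br0l !addr0. Qed.

Lemma brZr a (X Y : g) : {[X, a *: Y]} = a *: {[X, Y]}.
Proof. by have := br_linearr L X a Y 0; rewrite br0r !addr0. Qed.

Lemma brNl (X Y : g) : {[- X, Y]} = - {[X, Y]}.
Proof. by rewrite -scaleN1r brZl scaleN1r. Qed.

Lemma brNr (X Y : g) : {[X, - Y]} = - {[X, Y]}.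
Proof. by rewrite -scaleN1r brZr scaleN1r. Qed.

Lemma br_sumr I (r : seq I) (F : I -> g) (X : g) :
  {[X, \sum_(i <- r) F i]} = \sum_(i <- r) {[X, F i]}.
Proof.
by apply: (big_morph (br L X)) => [Y V|]; [exact: brDr|exact: br0r].
Qed.

Lemma brC (X Y : g) : {[Y, X]} = - {[X, Y]}.
Proof.
apply/eqP; rewrite -addr_eq0; apply/eqP.
by have := br_alt L (X + Y); rewrite brDl !brDr !br_alt addr0 add0r addrC.
Qed.

Lemma br_derivation (A X Y : g) :
  {[A, {[X, Y]}]} = {[ {[A, X]}, Y ]} + {[X, {[A, Y]}]}.
Proof.
have /eqP := br_jacobi L A X Y; rewrite -addrA addr_eq0 => /eqP ->.
by rewrite (brC A Y) (brC _ Y) brNr opprD !opprK addrC.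
Qed.

Lemma br_row (A X : g) : {[A, X]} = X *m ad L A.
Proof.
rewrite [in LHS](row_sum_delta X) br_sumr mulmx_sum_row.
apply: eq_bigr => j _; rewrite brZr; congr (_ *: _).
by apply/rowP => k; rewrite !mxE.
Qed.

Lemma ad_br (X Y : g) :
  ad L {[X, Y]} = ad L Y *m ad L X - ad L X *m ad L Y.
Proof.
apply/row_matrixP => i; rewrite !rowE mulmxBr !mulmxA -!br_row.
by rewrite (br_derivation X) addrK.
Qed.

Lemma killingC (X Y : g) : killing L X Y = killing L Y X.
Proof. by rewrite /killing mxtrace_mulC. Qed.

Lemma killing_ad (X Y V : g) : killing L {[X, Y]} V = killing L X {[Y, V]}.
Proof.
rewrite /killing !ad_br mulmxBl mulmxBr !raddfB /=; congr (_ - _).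
  by rewrite -mulmxA mxtrace_mulC mulmxA.
by rewrite mulmxA.
Qed.

Lemma adD (X Y : g) : ad L (X + Y) = ad L X + ad L Y.
Proof. by apply/row_matrixP => i; rewrite !rowE mulmxDr -!br_row brDl. Qed.

Lemma adZ a (X : g) : ad L (a *: X) = a *: ad L X.
Proof. by apply/row_matrixP => i; rewrite !rowE -scalemxAr -!br_row brZl. Qed.

Lemma killingDl (X Y V : g) : killing L (X + Y) V = killing L X V + killing L Y V.
Proof. by rewrite /killing adD mulmxDl raddfD. Qed.

Lemma killingZl a (X V : g) : killing L (a *: X) V = a * killing L X V.
Proof. by rewrite /killing adZ -scalemxAl linearZ. Qed.

Lemma killing0l (V : g) : killing L 0 V = 0.
Proof. by rewrite -(scale0r (0 : g)) killingZl mul0r. Qed.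

Lemma killingDr (X Y V : g) : killing L V (X + Y) = killing L V X + killing L V Y.
Proof. by rewrite !(killingC V) killingDl. Qed.

Lemma killing0r (V : g) : killing L V 0 = 0.
Proof. by rewrite killingC killing0l. Qed.

Lemma killingNr (X V : g) : killing L V (- X) = - killing L V X.
Proof. by rewrite -scaleN1r killingC killingZl mulN1r killingC. Qed.

Lemma killing_comb (X V : g) :
  killing L X V = \sum_j X 0 j * killing L (delta_mx 0 j) V.
Proof.
rewrite [in LHS](row_sum_delta X).
rewrite (big_morph (fun X => killing L X V) (id1 := 0) (op1 := +%R)).
- by apply: eq_bigr => j _; rewrite killingZl.
- by move=> ? ?; rewrite killingDl.
- exact: killing0l.
Qed.

Section Grading.
Variables (Z : g) (nu : nat).
Hypothesis hZ : is_grading_element L Z nu.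
Local Notation grade := (grade L Z).
Local Notation filt := (filt L Z nu).

Lemma grade_br i j (X Y : g) :
  grade i X -> grade j Y -> grade (i + j) {[X, Y]}.
Proof.
rewrite /Defs.grade /= br_derivation => -> ->.
by rewrite brZl brZr -scalerDl -intrD.
Qed.

Lemma gradeD j (X Y : g) : grade j X -> grade j Y -> grade j (X + Y).
Proof. by rewrite /Defs.grade /= brDr => -> ->; rewrite scalerDr. Qed.

Lemma gradeZ j a (X : g) : grade j X -> grade j (a *: X).
Proof. by rewrite /Defs.grade /= brZr => ->; rewrite !scalerA mulrC. Qed.

Lemma grade0 j : grade j 0.
Proof. by rewrite /Defs.grade /= br0r scaler0. Qed.

(** Eigenvectors for distinct eigenvalues of ad Z are independent; apply
    ad Z - w i to the relation and use induction. *)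
Lemma grade_independent (I : eqType) (s : seq I) (w : I -> int) (x : I -> g) :
  uniq s -> injective w -> (forall i, grade (w i) (x i)) ->
  \sum_(i <- s) x i = 0 -> forall i, i \in s -> x i = 0.
Proof.
move=> + wI; elim: s x => // i s IH x /= /andP[si us] xw.
rewrite big_cons => s0.
have xs k : k \in s -> x k = 0.
  move=> ks; pose y k := ((w k)%:~R - (w i)%:~R) *: x k.
  have /IH : forall k, grade (w k) (y k) by move=> l; exact: gradeZ.
  move=> /(_ us)/(_ _ _ ks); rewrite /y => yk0.
  suff /yk0/eqP : \sum_(j <- s) y j = 0.
    rewrite scaler_eq0 subr_eq0 eqr_int (inj_eq wI) => /orP[/eqP ki|/eqP//].
    by rewrite -ki ks in si.
  have /= := congr1 (fun V => {[Z, V]} - (w i)%:~R *: V) s0.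
  rewrite br0r scaler0 subr0 brDr xw scalerDr opprD addrACA subrr add0r.
  rewrite br_sumr scaler_sumr -sumrB => E.
  apply: etrans E.
  by apply: eq_bigr => l _; rewrite /y scalerBl xw.
move=> k; rewrite inE => /orP[/eqP ->|/xs//].
by move: s0; rewrite big_seq big1 ?addr0 // => l /xs.
Qed.

(** As g is the sum of the g_k with |k| <= nu, there are no further
    eigenvalues. *)
Lemma grade_outside j (X : g) : grade j X ->
  (forall k : 'I_(nu.*2.+1), (k : nat)%:Z - nu%:Z != j) -> X = 0.
Proof.
move=> Xj jk; have [x [xg XE]] : graded_sum nu grade X by rewrite (grading_full hZ).
pose w (o : option 'I_(nu.*2.+1)) : int :=
  if o is Some k then (k : nat)%:Z - nu%:Z else j.
pose y o := if o is Some k then x k else - X.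
have wI : injective w.
  case=> [k|] [l|] //= e; last 2 first.
  - by have := jk k; rewrite e eqxx.
  - by have := jk l; rewrite -e eqxx.
  by congr Some; apply: val_inj; move/addIr: e => [].
have yw o : grade (w o) (y o).
  by case: o => [k|] /=; [exact: xg|rewrite -scaleN1r; exact: gradeZ].
have := @grade_independent _ (None :: map Some (enum 'I_(nu.*2.+1))) w y.
move=> /(_ _ wI yw) H.
have /(_ None) : forall i, i \in None :: map Some (enum 'I_(nu.*2.+1)) -> y i = 0.
  apply: H.
    rewrite /= map_inj_uniq ?enum_uniq ?andbT; last by move=> ? ? [].
    by apply/negP => /mapP[].
  by rewrite big_cons big_map big_enum /= -XE addNr.
by rewrite inE eqxx => /(_ isT)/eqP; rewrite oppr_eq0 => /eqP.
Qed.

Lemma filt0 i : filt i 0.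
Proof.
exists (fun=> 0); split; last by rewrite big1.
by move=> k; case: ifP => // _; exact: grade0.
Qed.

Lemma filtD i (X Y : g) : filt i X -> filt i Y -> filt i (X + Y).
Proof.
move=> [x [xg ->]] [y [yg ->]]; exists (fun k => x k + y k).
split; last by rewrite big_split.
move=> k; have := xg k; have := yg k; case: ifP => _; first by move=> ? ?; exact: gradeD.
by move=> /= -> ->; rewrite addr0.
Qed.

Lemma filtZ i a (X : g) : filt i X -> filt i (a *: X).
Proof.
move=> [x [xg ->]]; exists (fun k => a *: x k).
split; last by rewrite scaler_sumr.
move=> k; have := xg k; case: ifP => _; first exact: gradeZ.
by move=> /= ->; rewrite scaler0.
Qed.

Lemma grade_filt i j (X : g) : i <= j -> grade j X -> filt i X.
Proof.
move=> ij Xj; have [[k kj]|nk] :=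
  pselect (exists k : 'I_(nu.*2.+1), (k : nat)%:Z - nu%:Z = j).
  exists (fun l => if l == k then X else 0); split.
    move=> l; case: eqP => [->|_]; first by rewrite kj ij.
    by case: ifP => // _; exact: grade0.
  by rewrite -big_mkcond big_pred1_eq.
suff -> : X = 0 by exact: filt0.
apply: (grade_outside Xj) => k; apply/eqP => kj; apply: nk; by exists k.
Qed.

Lemma filt_ind i (P : g -> Prop) : P 0 ->
  (forall X Y, P X -> P Y -> P (X + Y)) ->
  (forall j X, i <= j -> grade j X -> P X) ->
  forall X, filt i X -> P X.
Proof.
move=> P0 PD Pg X [x [xg ->]]; apply: big_ind => // k _.
have := xg k; case: ifP => [ik|_ /= ->] //; exact: Pg.
Qed.

Lemma filt_mono i j (X : g) : i <= j -> filt j X -> filt i X.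
Proof.
move=> ij; apply: filt_ind; [exact: filt0|by move=> ? ?; exact: filtD|].
by move=> k Y jk; apply: grade_filt; exact: le_trans jk.
Qed.

Lemma filt_br i j (X Y : g) :
  filt i X -> filt j Y -> filt (i + j) {[X, Y]}.
Proof.
move=> Xi Yj; move: X Xi; apply: filt_ind.
- by rewrite br0l; exact: filt0.
- by move=> X V; rewrite brDl; exact: filtD.
move=> k X ik Xk; move: Y Yj; apply: filt_ind.
- by rewrite br0r; exact: filt0.
- by move=> Y V; rewrite brDr; exact: filtD.
move=> l Y jl Yl; apply: (@grade_filt _ (k + l)); first exact: lerD.
exact: grade_br.
Qed.

(** Invariance of the Killing form under Z gives (i + j) B (X, Y) = 0. *)
Lemma killing_grade i j (X Y : g) : i + j != 0 ->
  grade i X -> grade j Y -> killing L X Y = 0.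
Proof.
move=> ij0 Xi Yj; have := killing_ad X Z Y.
rewrite brC Xi Yj killingC killingNr killingC killingZl.
rewrite [RHS]killingC killingZl [killing L Y X]killingC => /eqP.
rewrite -subr_eq0 -opprD oppr_eq0 -mulrDl mulf_eq0 -intrD intr_eq0.
by rewrite (negbTE ij0) => /eqP.
Qed.

Lemma killing_filt i j (X Y : g) : 0 < i + j ->
  filt i X -> filt j Y -> killing L X Y = 0.
Proof.
move=> ij Xi Yj; move: X Xi; apply: filt_ind.
- exact: killing0l.
- by move=> X V hX hV; rewrite killingDl hX hV addr0.
move=> k X ik Xk; move: Y Yj; apply: filt_ind.
- exact: killing0r.
- by move=> Y V hY hV; rewrite killingDr hY hV addr0.
move=> l Y jl Yl; apply: (killing_grade _ Xk Yl).
by rewrite gt_eqF // (lt_le_trans ij) // lerD.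
Qed.

End Grading.
End LieAlgebra.

(** * Tensors and the codifferential *)

(** A set closed under linear operations is a subspace in the sense of vector
    spaces with decidable membership: enlarge a subspace contained in it until
    the dimension cannot grow. *)
Lemma subspace_vspace (K : fieldType) (V : vectType K) (B : V -> Prop) :
  B 0 -> (forall x y, B x -> B y -> B (x + y)) ->
  (forall a x, B x -> B (a *: x)) ->
  exists U : {vspace V}, forall x, B x <-> x \in U.
Proof.
move=> B0 BD BZ.
pose sub (U : {vspace V}) := forall x, x \in U -> B x.
have grow k : (k <= \dim {:V})%N -> (exists2 U, sub U & \dim U = k) \/
    exists2 U : {vspace V}, sub U & forall x, B x -> x \in U.
  elim: k => [_|k IH kd].
    left; exists 0%VS; last by rewrite dimv0.
    by move=> x; rewrite memv0 => /eqP ->.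
  have [[U sU Uk]|] := IH (ltnW kd); last by right.
  have [UB|] := pselect (forall x, B x -> x \in U); first by right; exists U.
  move=> /existsNP[x /not_implyP[Bx xU]]; left.
  exists (U + <[x]>)%VS.
    by move=> _ /memv_addP[y yU [_ /vlineP[a ->] ->]]; apply: BD; [exact: sU|exact: BZ].
  rewrite dimv_disjoint_sum.
    have x0 : x != 0 by apply: contra_not_neq xU => ->; exact: mem0v.
    by rewrite Uk dim_vline x0 addn1.
  apply/eqP; rewrite -subv0; apply/subvP => y; rewrite memv_cap => /andP[yU /vlineP[a ya]].
  rewrite memv0 ya scaler_eq0; apply/orP; left; apply: contraT => a0.
  case: xU; rewrite -[x](scalerK a0) -ya; exact: memvZ.
have [[U sU Ud]|[U sU UB]] := grow _ (leqnn _); last first.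
  by exists U => x; split; [exact: UB|exact: sU].
exists U => x; split; last exact: sU.
have /eqP -> : U == fullv by rewrite eqEdim subvf Ud /=.
by rewrite memvf.
Qed.

Section Tensors.
Variables (K : numFieldType) (d : nat) (L : lie_algebra K d).
Local Notation g := 'rV[K]_d.
Local Notation "{[ X , Y ]}" := (br L X Y) (at level 0, X, Y at level 99).
Local Notation form := (form_of_chain L).
Local Notation e j := (delta_mx 0 j : g).

Lemma form_linear a (S T : tensor2 K d) X Y :
  form (a *: S + T) X Y = a *: form S X Y + form T X Y.
Proof.
rewrite scaler_sumr -big_split; apply: eq_bigr => i _ /=.
rewrite scaler_sumr -big_split; apply: eq_bigr => j _ /=.
by rewrite !ffunE scalerDr !scalerA mulrC.
Qed.

Lemma form_sum (n : nat) (F : 'I_n -> tensor2 K d) X Y :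
  form (\sum_k F k) X Y = \sum_k form (F k) X Y.
Proof.
apply: (big_morph (fun T => form T X Y)) => [S T|].
  by rewrite -[S]scale1r form_linear !scale1r.
by rewrite /form_of_chain big1 // => i _; rewrite big1 // => j _; rewrite ffunE scaler0.
Qed.

(** The identification of p_+ with the dual of g / p is equivariant, by
    invariance of the Killing form. *)
Lemma form_act2 A (T : tensor2 K d) X Y :
  form (act2 L A T) X Y =
  {[A, form T X Y]} - form T {[A, X]} Y - form T X {[A, Y]}.
Proof.
have killA X' k : \sum_i killing L (e i) X' * {[A, e k]} 0 i =
    - killing L (e k) {[A, X']}.
  under eq_bigr do rewrite mulrC.
  by rewrite -killing_comb (brC L (e k) A) killingC killingNr killingC killing_ad.
have E1 : {[A, form T X Y]} = \sum_i \sum_j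
    (killing L (e i) X * killing L (e j) Y) *: {[A, T (i, j)]}.
  rewrite br_sumr; apply: eq_bigr => i _; rewrite br_sumr.
  by apply: eq_bigr => j _; rewrite brZr.
have E2 : - form T {[A, X]} Y = \sum_i \sum_j
    (killing L (e i) X * killing L (e j) Y) *:
    \sum_k {[A, e k]} 0 i *: T (k, j).
  under [RHS]eq_bigr do under eq_bigr do rewrite scaler_sumr.
  under [RHS]eq_bigr do rewrite exchange_big.
  rewrite [RHS]exchange_big /= -sumrN; apply: eq_bigr => k _.
  rewrite exchange_big /= -sumrN; apply: eq_bigr => j _.
  under eq_bigr do rewrite scalerA mulrAC.
  by rewrite -scaler_suml -mulr_suml killA mulNr scaleNr.
have E3 : - form T X {[A, Y]} = \sum_i \sum_j
    (killing L (e i) X * killing L (e j) Y) *: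
    \sum_k {[A, e k]} 0 j *: T (i, k).
  rewrite -sumrN; apply: eq_bigr => i _.
  under [RHS]eq_bigr do rewrite scaler_sumr.
  rewrite exchange_big /= -sumrN; apply: eq_bigr => k _.
  under eq_bigr do rewrite scalerA -mulrA.
  by rewrite -scaler_suml -mulr_sumr killA mulrN scaleNr.
rewrite E1 E2 E3 -!big_split; apply: eq_bigr => i _ /=.
rewrite -!big_split; apply: eq_bigr => j _ /=.
by rewrite ffunE big_split /= !scalerDr addrA.
Qed.

(** kappa is horizontal, because p_+ is orthogonal to p. *)
Lemma form_chains2 Z nu T X Y :
  chains2 L Z nu T -> filt L Z nu 0 X -> form T X Y = 0.
Proof.
move=> [n [P [Q [v [PQ ->]]]]] X0; rewrite form_sum big1 // => k _.
have [Pk Qk] := PQ k.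
rewrite form_of_wedge (killing_filt _ Pk X0) // (killing_filt _ Qk X0) //.
by rewrite !mul0r subr0 scale0r.
Qed.

Lemma codiff3D (S T : tensor3 K d) :
  codiff3 L (S + T) = codiff3 L S + codiff3 L T.
Proof.
apply/ffunP => ab; rewrite !ffunE.
have U a b : \sum_i \sum_j {[e i, e j]} 0 a *: (S + T) (i, j, b) =
    \sum_i \sum_j {[e i, e j]} 0 a *: S (i, j, b) +
    \sum_i \sum_j {[e i, e j]} 0 a *: T (i, j, b).
  rewrite -big_split; apply: eq_bigr => i _; rewrite -big_split.
  by apply: eq_bigr => j _ /=; rewrite ffunE scalerDr.
rewrite !U; under eq_bigr do rewrite ffunE brDr.
rewrite big_split /=.
have alg (x y p q r s : g) c : - (x + y) - c *: (p + q - (r + s)) =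
    - x - c *: (p - r) + (- y - c *: (q - s)).
  by apply/rowP => l; rewrite !mxE; ring.
exact: alg.
Qed.

Lemma codiff3Z a (T : tensor3 K d) : codiff3 L (a *: T) = a *: codiff3 L T.
Proof.
apply/ffunP => ab; rewrite !ffunE.
have U a' b : \sum_i \sum_j {[e i, e j]} 0 a' *: (a *: T) (i, j, b) =
    a *: \sum_i \sum_j {[e i, e j]} 0 a' *: T (i, j, b).
  rewrite scaler_sumr; apply: eq_bigr => i _; rewrite scaler_sumr.
  by apply: eq_bigr => j _ /=; rewrite ffunE !scalerA mulrC.
rewrite !U; under eq_bigr do rewrite ffunE brZr.
rewrite -scaler_sumr.
have alg (x p q : g) c :
    - (a *: x) - c *: (a *: p - a *: q) = a *: (- x - c *: (p - q)).
  by apply/rowP => l; rewrite !mxE; ring.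
exact: alg.
Qed.

Lemma codiff3_sum (n : nat) (F : 'I_n -> tensor3 K d) :
  codiff3 L (\sum_k F k) = \sum_k codiff3 L (F k).
Proof.
apply: (big_morph (codiff3 L)) => [S T|]; first exact: codiff3D.
by rewrite -(scale0r (0 : tensor3 K d)) codiff3Z scale0r.
Qed.

Lemma act2D A (S T : tensor2 K d) : act2 L A (S + T) = act2 L A S + act2 L A T.
Proof.
apply/ffunP => ij; rewrite !ffunE brDr addrACA; congr (_ + _).
by rewrite -big_split; apply: eq_bigr => k _ /=; rewrite !ffunE !scalerDr addrACA.
Qed.

Lemma act2Z A a (T : tensor2 K d) : act2 L A (a *: T) = a *: act2 L A T.
Proof.
apply/ffunP => ij; rewrite !ffunE brZr scalerDr; congr (_ + _).
rewrite scaler_sumr; apply: eq_bigr => k _ /=.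
by rewrite !ffunE scalerDr !scalerA; congr (_ *: _ + _ *: _); rewrite mulrC.
Qed.

Lemma act2_sum A (n : nat) (F : 'I_n -> tensor2 K d) :
  act2 L A (\sum_k F k) = \sum_k act2 L A (F k).
Proof.
apply: (big_morph (act2 L A)) => [S T|]; first exact: act2D.
by rewrite -(scale0r (0 : tensor2 K d)) act2Z !scale0r.
Qed.

Lemma act2Dl A B (T : tensor2 K d) : act2 L (A + B) T = act2 L A T + act2 L B T.
Proof.
apply/ffunP => ij; rewrite !ffunE brDl addrACA; congr (_ + _).
rewrite -big_split; apply: eq_bigr => k _ /=.
by rewrite brDl !mxE !scalerDl addrACA.
Qed.

Lemma codiff2_sum (n : nat) (F : 'I_n -> tensor2 K d) :
  codiff2 L (\sum_k F k) = \sum_k codiff2 L (F k).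
Proof.
apply: (big_morph (codiff2 L)) => [S T|].
  apply/ffunP => a; rewrite !ffunE addrACA -opprD -scalerDr -!big_split /=.
  congr (_ - _ *: _); apply: eq_bigr => i _; first by rewrite ffunE brDr.
  by rewrite -big_split; apply: eq_bigr => j _ /=; rewrite ffunE scalerDr.
apply/ffunP => a; rewrite !ffunE !big1 ?scaler0 ?subr0 // => i _.
  by rewrite big1 // => j _; rewrite ffunE scaler0.
by rewrite ffunE br0r.
Qed.

Definition wedge1 (A : g) (t : tensor1 K d) : tensor2 K d :=
  [ffun ij => A 0 ij.1 *: t ij.2 - A 0 ij.2 *: t ij.1].

Lemma wedge1_pure A X v : wedge1 A (pure1 X v) = wedge2 A X v.
Proof.
by apply/ffunP => ij; rewrite !ffunE !scalerA -scalerBl [A 0 ij.2 * _]mulrC.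
Qed.

Lemma wedge1D A s t : wedge1 A (s + t) = wedge1 A s + wedge1 A t.
Proof.
by apply/ffunP => ij; rewrite !ffunE !scalerDr opprD addrACA.
Qed.

Lemma wedge1N A t : wedge1 A (- t) = - wedge1 A t.
Proof.
by apply/ffunP => ij; rewrite !ffunE !scalerN opprD.
Qed.

Lemma wedge1_0 A : wedge1 A 0 = 0.
Proof. by apply/ffunP => ij; rewrite !ffunE !scaler0 subr0. Qed.

Lemma wedge1_sum A (n : nat) (F : 'I_n -> tensor1 K d) :
  wedge1 A (\sum_k F k) = \sum_k wedge1 A (F k).
Proof. by apply: (big_morph (wedge1 A)); [exact: wedge1D|exact: wedge1_0]. Qed.

(** The homotopy formula of Cartan for the homology differential. *)
Lemma cartan_wedge A X Y v :
  codiff3 L (wedge3 A X Y v) =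
  - act2 L A (wedge2 X Y v) - wedge1 A (codiff2 L (wedge2 X Y v)).
Proof.
rewrite codiff3_wedge act2_wedge codiff2_wedge !(wedge1D, wedge1N) !wedge1_pure.
by apply/ffunP => -[i j]; rewrite !ffunE /=; apply/rowP => c; rewrite !mxE; ring.
Qed.

Section Homology.
Variables (Z : g) (nu : nat).
Hypothesis hZ : is_grading_element L Z nu.
Local Notation filt := (filt L Z nu).
Local Notation boundaries := (boundaries L Z nu).

(** If T is a cycle, then - A . T is by [cartan_wedge] the boundary of A /\ T;
    so p_+ acts trivially on homology. *)
Lemma boundaries_act T A : chains2 L Z nu T -> codiff2 L T = 0 -> filt 1 A ->
  boundaries (- act2 L A T).
Proof.
move=> [n [X [Y [v [XY TE]]]]] dT A1.
exists (\sum_k wedge3 A (X k) (Y k) (v k)).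
  exists n, (fun=> A), X, Y, v; split => // k; by have [] := XY k.
rewrite codiff3_sum; under eq_bigr do rewrite cartan_wedge.
by rewrite sumrB sumrN -act2_sum -wedge1_sum -codiff2_sum -TE dT wedge1_0 subr0.
Qed.

Lemma boundariesD S T : boundaries S -> boundaries T -> boundaries (S + T).
Proof.
move=> [_ [n [X [Y [V [v [XYV ->]]]]]] <-].
move=> [_ [n' [X' [Y' [V' [v' [XYV' ->]]]]]] <-].
rewrite -codiff3D.
pose cat T (x : 'I_n -> T) (x' : 'I_n' -> T) (k : 'I_(n + n')) :=
  match fintype.split k with inl i => x i | inr i => x' i end.
eexists; last reflexivity.
exists (n + n')%N, (cat _ X X'), (cat _ Y Y'), (cat _ V V'), (cat _ v v').
split; first by move=> k; rewrite /cat; case: (fintype.split k).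
rewrite big_split_ord /=; congr (_ + _); apply: eq_bigr => k _; rewrite /cat.
  by have /= -> := unsplitK (inl k : 'I_n + 'I_n').
by have /= -> := unsplitK (inr k : 'I_n + 'I_n').
Qed.

Lemma boundariesZ a T : boundaries T -> boundaries (a *: T).
Proof.
move=> [_ [n [X [Y [V [v [XYV ->]]]]]] <-]; rewrite -codiff3Z.
eexists; last reflexivity.
exists n, X, Y, V, (fun k => a *: v k); split => //.
rewrite scaler_sumr; apply: eq_bigr => k _.
by apply/ffunP => -[[i j] l]; rewrite !ffunE !scalerA mulrC.
Qed.

Lemma boundaries0 : boundaries 0.
Proof.
exists 0; last by rewrite -(scale0r (0 : tensor3 K d)) codiff3Z scale0r.
by exists 0%N, (fun=> 0), (fun=> 0), (fun=> 0), (fun=> 0); split => [[]|]//; rewrite big_ord0.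
Qed.

Lemma boundariesN T : boundaries T -> boundaries (- T).
Proof. by rewrite -scaleN1r; exact: boundariesZ. Qed.

Lemma boundaries_wedge X Y V v : filt 1 X -> filt 1 Y -> filt 1 V ->
  boundaries (codiff3 L (wedge3 X Y V v)).
Proof.
move=> X1 Y1 V1; eexists; last reflexivity.
by exists 1%N, (fun=> X), (fun=> Y), (fun=> V), (fun=> v); split => //; rewrite big_ord1.
Qed.

Lemma act2_codiff3_wedge A X Y V v :
  act2 L A (codiff3 L (wedge3 X Y V v)) =
  codiff3 L (wedge3 {[A, X]} Y V v) + codiff3 L (wedge3 X {[A, Y]} V v)
  + codiff3 L (wedge3 X Y {[A, V]} v) + codiff3 L (wedge3 X Y V {[A, v]}).
Proof.
have act2N S : act2 L A (- S) = - act2 L A S.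
  by rewrite -scaleN1r act2Z scaleN1r.
rewrite !codiff3_wedge !(act2D, act2N) !act2_wedge.
rewrite ![br L A (br L _ _)]br_derivation.
by apply/ffunP => -[i j]; rewrite !ffunE /=; apply/rowP => c; rewrite !mxE; ring.
Qed.

(** The differential is equivariant ([act2_codiff3_wedge]), and the chains on
    p_+ form a p-module. *)
Lemma boundaries_grade0 A T : filt 0 A -> boundaries T ->
  boundaries (act2 L A T).
Proof.
move=> A0 [_ [n [X [Y [V [v [XYV ->]]]]]] <-].
rewrite codiff3_sum act2_sum; apply: big_ind => [||k _].
- exact: boundaries0.
- exact: boundariesD.
have [Xk Yk Vk] := XYV k; rewrite act2_codiff3_wedge.
have F U : filt 1 U -> filt 1 {[A, U]} by move/(filt_br hZ A0).
by apply: boundariesD; [apply: boundariesD; [apply: boundariesD|]|];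
  apply: boundaries_wedge => //; exact: F.
Qed.

(** Projection along a complement of the boundaries.  Its coordinates are
    enough linear functionals to test membership in the image of d*. *)
Lemma boundaries_kernel :
  exists q : 'End(tensor2 K d), forall T, boundaries T <-> q T = 0.
Proof.
have [U UB] := @subspace_vspace _ _ boundaries boundaries0 boundariesD boundariesZ.
exists (\1 - projv U)%VF => T; rewrite UB; split => [TU|].
  by rewrite add_lfunE opp_lfunE id_lfunE projv_id // subrr.
by rewrite add_lfunE opp_lfunE id_lfunE => /eqP; rewrite subr_eq0 => /eqP ->; exact: memv_proj.
Qed.

End Homology.

Definition form_map (T : tensor2 K d) : tensor2 K d :=
  [ffun ij => form T (e ij.1) (e ij.2)].

Lemma form_map_linear : linear form_map.
Proof. by move=> a S T; apply/ffunP => ij; rewrite !ffunE form_linear. Qed.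

HB.instance Definition _ :=
  GRing.isLinear.Build K (tensor2 K d) (tensor2 K d) _ form_map form_map_linear.

(** The Gram matrix G of the Killing form.  On each component of the values, T
    is a matrix S, and [form_map] sends S to G^T S G. *)
Definition gram : 'M[K]_d := \matrix_(i, j) killing L (e i) (e j).

Lemma gram_unit : semisimple L -> gram \in unitmx.
Proof.
move=> hss; rewrite -row_free_unit -kermx_eq0; apply/eqP/row_matrixP => i.
rewrite row0; apply: hss => Y; set X := row i _.
have X0 : X *m gram = 0 by rewrite -row_mul mulmx_ker row0.
rewrite killing_comb; under eq_bigr => j _ do rewrite killingC killing_comb mulr_sumr.
rewrite exchange_big big1 //= => k _.
under eq_bigr => j _ do rewrite killingC mulrCA.
rewrite -mulr_sumr.
have -> : \sum_j X 0 j * killing L (e j) (e k) = (X *m gram) 0 k.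
  by rewrite [RHS]mxE; apply: eq_bigr => j _; rewrite [gram _ _]mxE.
by rewrite X0 mxE mulr0.
Qed.

Lemma form_map_inj : semisimple L -> injective form_map.
Proof.
move=> hss; have gu := gram_unit hss.
apply: raddf_inj => T T0; apply/ffunP => -[i j]; apply/rowP => c; rewrite !ffunE mxE.
pose S := \matrix_(i, j) T (i, j) 0 c.
have SE : gram^T *m S *m gram = 0.
  apply/matrixP => a b; have := congr1 (fun F : tensor2 K d => F (a, b) 0 c) T0.
  rewrite !ffunE mxE /= => E; rewrite !mxE -[RHS]E /form_of_chain.
  rewrite summxE; under [RHS]eq_bigr do rewrite summxE.
  under [LHS]eq_bigr do rewrite mxE mulr_suml.
  rewrite exchange_big /=; apply: eq_bigr => k _; apply: eq_bigr => l _.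
  by rewrite !mxE mulrAC.
have := congr1 (fun M => invmx gram^T *m M *m invmx gram) SE.
rewrite mulmxA mulmxK // mulKmx ?unitmx_tr // mulmx0 mul0mx => /matrixP/(_ i j).
by rewrite !mxE.
Qed.

(** Since the Killing form is nondegenerate, [form_map] is invertible, so that
    every functional of kappa is a combination of the functions
    kappa (e_i, e_j), for which there are differential equations. *)
Lemma functional_of_form (hss : semisimple L) (phi : 'End(tensor2 K d)) ab c :
  exists w : 'I_d -> 'I_d -> 'I_d -> K, forall T : tensor2 K d,
    phi T ab 0 c = \sum_i \sum_j \sum_k w i j k * form T (e i) (e j) 0 k.
Proof.
pose F : 'End(tensor2 K d) := linfun form_map.
have F0 : lker F == 0%VS.
  by apply/lker0P => S T; rewrite !lfunE => /(form_map_inj hss).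
pose unit_tensor i j k : tensor2 K d := [ffun ij => (ij == (i, j))%:R *: e k].
exists (fun i j k => phi ((F^-1)%VF (unit_tensor i j k)) ab 0 c) => T.
have decomp (S : tensor2 K d) :
    S = \sum_i \sum_j \sum_k S (i, j) 0 k *: unit_tensor i j k.
  apply/ffunP => -[i j]; rewrite sum_ffunE (bigD1 i) //= [X in _ + X]big1; last first.
    move=> i' i'i; rewrite sum_ffunE big1 // => j' _; rewrite sum_ffunE big1 // => k _.
    by rewrite !ffunE xpair_eqE eq_sym (negbTE i'i) scale0r scaler0.
  rewrite addr0 sum_ffunE (bigD1 j) //= [X in _ + X]big1; last first.
    move=> j' j'j; rewrite sum_ffunE big1 // => k _.
    by rewrite !ffunE xpair_eqE [j == _]eq_sym (negbTE j'j) andbF scale0r scaler0.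
  rewrite addr0 sum_ffunE [LHS]row_sum_delta; apply: eq_bigr => k _.
  by rewrite !ffunE eqxx scale1r.
rewrite -{1}(lker0_lfunK F0 T) {1}[F T]decomp !linear_sum sum_ffunE summxE.
apply: eq_bigr => i _; rewrite !linear_sum sum_ffunE summxE.
apply: eq_bigr => j _; rewrite !linear_sum sum_ffunE summxE.
apply: eq_bigr => k _; rewrite !linearZ ffunE mxE mulrC /=; congr (_ * _).
by rewrite lfunE ffunE.
Qed.

End Tensors.

(** * Symmetries and harmonic curvature in a chart *)

Section AnnihilatorOfCoset.
Variables (K : numFieldType) (d : nat) (L : lie_algebra K d).
Variables (Z : 'rV[K]_d) (nu : nat).
Hypothesis hZ : is_grading_element L Z nu.

(** The definition of the annihilator involves all representatives of the
    class; one suffices, as g_0 preserves the image of d*. *)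
Lemma ann_of_boundary T A : grade L Z 0 A ->
  boundaries L Z nu (act2 L A T) -> ann L Z nu (homology_class L Z nu T) A.
Proof.
move=> A0 AT; split => //.
have F0 : filt L Z nu 0 A by exact: (grade_filt hZ _ A0).
have act2N S : act2 L A (- S) = - act2 L A S by rewrite -scaleN1r act2Z scaleN1r.
rewrite eqEsubset; split => [S [T']|S]; rewrite /homology_class /=.
  move=> TT' ST'.
  have -> : S - 0 = (S - act2 L A T') + (act2 L A (T' - T) + act2 L A T).
    by rewrite -act2D !subrK subr0.
  by apply: boundariesD => //; apply: boundariesD => //; exact: boundaries_grade0.
rewrite subr0 => BS; exists T; rewrite /homology_class /=.
  by rewrite subrr; exact: boundaries0.
by apply: boundariesD => //; exact: boundariesN.
Qed.

End AnnihilatorOfCoset.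

Section SymmetryInChart.
Variables (R : realType) (K : numFieldType).
Hypothesis hK : K = R :> numFieldType \/ K = R[i] :> numFieldType.
Variables (d : nat) (O : set 'rV[K]_d).
Hypothesis oO : open O.
Local Notation g := 'rV[K]_d.
Variable W : g -> 'M[K]_d.
Hypothesis W_unit : forall q, O q -> W q \in unitmx.
Hypothesis W_smooth : smooth_mx O W.
Variables (L : lie_algebra K d) (Z : g) (nu : nat).
Hypothesis hss : semisimple L.
Hypothesis hZ : is_grading_element L Z nu.
Local Notation filt := (filt L Z nu).
Local Notation form := (form_of_chain L).
Local Notation e j := (delta_mx 0 j : g).
Local Notation along := (frame_derivative W).
Variable kappa : g -> tensor2 K d.
Hypothesis kappa_chain : forall q, O q -> chains2 L Z nu (kappa q).
Hypothesis kappa_torsion : forall A B q, O q ->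
  torsion W A B q = br L A B - form (kappa q) A B.
Hypothesis kappa_normal : forall q, O q -> codiff2 L (kappa q) = 0.

Lemma torsionC A B q : torsion W A B q = - torsion W B A q.
Proof. by apply/rowP => c; rewrite !mxE opprB. Qed.

Lemma formE A B q : O q -> form (kappa q) A B = br L A B - torsion W A B q.
Proof. by move=> Oq; rewrite kappa_torsion // opprB addrC subrK. Qed.

Lemma formC A B q : O q -> form (kappa q) A B = - form (kappa q) B A.
Proof. by move=> Oq; rewrite !formE // torsionC brC opprB opprK addrC. Qed.

Lemma torsion_pl A B q : O q -> filt 0 A -> torsion W A B q = br L A B.
Proof.
move=> Oq A0; rewrite kappa_torsion // (form_chains2 _ (kappa_chain Oq)) //.
by rewrite subr0.
Qed.

Lemma torsion_pr A B q : O q -> filt 0 B -> torsion W A B q = br L A B.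
Proof. by move=> Oq B0; rewrite torsionC torsion_pl // brC opprK. Qed.

Lemma smooth_form_kappa A B c : smooth O (fun q => form (kappa q) A B 0 c).
Proof.
have : smooth O (fun q => br L A B 0 c - torsion W A B q 0 c).
  by apply: smoothB => //; [exact: smooth_cst|exact: smooth_torsion].
apply: smooth_eq => // q Oq; rewrite formE // [RHS]mxE.
by congr (_ + _); rewrite [RHS]mxE.
Qed.

Lemma along_vec_cst A F (B : g) q : O q -> (forall y, O y -> F y = B) ->
  along_vec W A F q = 0.
Proof.
move=> Oq FB; apply/rowP => c; rewrite along_vecE mxE.
apply: etrans (along_cst W A (B 0 c) q); apply: (along_eq oO) => // y Oy.
by rewrite FB.
Qed.

Lemma formNr (T : tensor2 K d) A B : form T A (- B) = - form T A B.
Proof.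
rewrite -sumrN; apply: eq_bigr => i _; rewrite -sumrN; apply: eq_bigr => j _.
by rewrite killingNr mulrN scaleNr.
Qed.

(** In the Bianchi identity for A in p and B, C in g, the torsions
    [C, A] and [A, B] are constant, and what remains of the brackets cancels by
    the Jacobi identity of g, except for the action of A on kappa. *)
Lemma along_form A B C q c : O q -> filt 0 A ->
  along A (fun y => form (kappa y) B C 0 c) q =
  - form (act2 L A (kappa q)) B C 0 c.
Proof.
move=> Oq A0.
have := bianchi hK oO W_unit W_smooth A B C Oq.
rewrite (@along_vec_cst B _ (br L C A)) //; last by move=> y Oy; exact: torsion_pr.
rewrite (@along_vec_cst C _ (br L A B)) //; last by move=> y Oy; exact: torsion_pl.
rewrite !add0r torsion_pl // (torsion_pr C Oq A0) (torsion_pl B Oq A0).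
rewrite !kappa_torsion // brDr brNr => J.
have E : along A (fun y => form (kappa y) B C 0 c) q =
    - along_vec W A (torsion W B C) q 0 c.
  have ts := smooth_torsion oO W_unit W_smooth B C 0 c.
  rewrite along_vecE -(alongN W A ts Oq).
  apply: etrans (_ : along A (fun y => br L B C 0 c + - torsion W B C y 0 c) q = _).
    apply: (along_eq oO) => // y Oy; rewrite formE // [LHS]mxE.
    by congr (_ + _); rewrite [LHS]mxE.
  apply: etrans (alongD W A (smooth_cst oO (br L B C 0 c)) (smoothN oO ts) Oq) _.
  by rewrite along_cst add0r.
rewrite E form_act2; congr (- (_ : g) 0 c).
have FC : form (kappa q) C (br L A B) = - form (kappa q) (br L A B) C by exact: formC.
have BA : form (kappa q) B (br L C A) = - form (kappa q) B (br L A C).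
  by rewrite (brC L A C) formNr.
rewrite FC BA in J.
have alg (v x a y b z c' : g) : v + (x - a) + (y - b) + (z - c') = 0 ->
    x + y + z = 0 -> v = a + b + c'.
  move=> H0 H1; apply/eqP; rewrite -subr_eq0; apply/eqP.
  rewrite -[RHS](subrr (0 : g)) -{1}H0 -H1.
  by apply/rowP => l; rewrite !mxE; ring.
rewrite (alg _ _ _ _ _ _ _ J (br_jacobi L A B C)).
by apply/rowP => l; rewrite !mxE; ring.
Qed.

Lemma along_functional (w : 'I_d -> 'I_d -> 'I_d -> K) A q : O q ->
  along A (fun y =>
    \sum_i \sum_j \sum_k w i j k * form (kappa y) (e i) (e j) 0 k) q =
  \sum_i \sum_j \sum_k
    w i j k * along A (fun y => form (kappa y) (e i) (e j) 0 k) q.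
Proof.
move=> Oq; pose F i j k y := w i j k * form (kappa y) (e i) (e j) 0 k.
have sf i j k := smooth_form_kappa (e i) (e j) k.
have sF i j k : smooth O (F i j k) by apply: smoothM => //; exact: smooth_cst.
have s1 i j : smooth O (fun y => \sum_k F i j k y) by exact: smooth_sum.
have s2 i : smooth O (fun y => \sum_j \sum_k F i j k y) by exact: smooth_sum.
rewrite (along_sum oO W A _ s2 Oq); apply: eq_bigr => i _.
rewrite (along_sum oO W A _ (s1 i) Oq); apply: eq_bigr => j _.
rewrite (along_sum oO W A _ (sF i j) Oq); apply: eq_bigr => k _.
rewrite (alongM W A (smooth_cst oO (w i j k)) (sf i j k) Oq).
by rewrite along_cst mul0r add0r.
Qed.

(** Here cls has the image of d* as its kernel: it stands for passing from kappa
    to the harmonic curvature. *)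
Section Functional.
Variables (cls : 'End(tensor2 K d)).
Hypothesis cls_kernel : forall T, boundaries L Z nu T <-> cls T = 0.
Variables (ab : 'I_d * 'I_d) (c : 'I_d).
Definition harmonic_coord q := cls (kappa q) ab 0 c.
Local Notation H := harmonic_coord.

Lemma smooth_harmonic_coord : smooth O H.
Proof.
have [w wE] := functional_of_form hss cls ab c.
have : smooth O (fun q => \sum_i \sum_j \sum_k w i j k * form (kappa q) (e i) (e j) 0 k).
  do 3!(apply: smooth_sum => // ?); apply: smoothM => //; first exact: smooth_cst.
  exact: smooth_form_kappa.
by apply: smooth_eq => // q Oq; rewrite /H wE.
Qed.

Lemma along_harmonic_coord A q : O q -> filt 0 A ->
  along A H q = - cls (act2 L A (kappa q)) ab 0 c.
Proof.
move=> Oq A0; have [w wE] := functional_of_form hss cls ab c.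
apply: etrans (along_eq oO W A Oq (fun y _ => wE (kappa y))) _.
rewrite along_functional // wE -sumrN; apply: eq_bigr => i _.
rewrite -sumrN; apply: eq_bigr => j _; rewrite -sumrN; apply: eq_bigr => k _.
by rewrite along_form // mulrN.
Qed.

Lemma along_harmonic_pplus A q : O q -> filt 1 A -> along A H q = 0.
Proof.
move=> Oq A1; rewrite along_harmonic_coord //; last exact: filt_mono A1.
have := boundaries_act (kappa_chain Oq) (kappa_normal Oq) A1.
by rewrite cls_kernel linearN => /eqP; rewrite oppr_eq0 => /eqP ->; rewrite ffunE mxE oppr0.
Qed.

Local Notation iter_along Ys h := (foldr (fun Y k => along Y k) h Ys).

Lemma smooth_iter_along (Ys : seq g) h : smooth O h -> smooth O (iter_along Ys h).
Proof. by move=> hs; elim: Ys => //= Y Ys IH; exact: smooth_along. Qed.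

(** Commute D_X past D_Y: both D_[X, Y] and D_X act on fewer derivatives of H,
    and [X, Y] drops by one step in the filtration only. *)
Lemma iter_along_vanish (Ys : seq g) X q : O q ->
  (forall Y, Y \in Ys -> filt (-1) Y) -> filt (size Ys).+1%:Z X ->
  along X (iter_along Ys H) q = 0.
Proof.
elim: Ys X q => [|Y Ys IH] X q Oq Ysf Xf; first exact: along_harmonic_pplus.
have Hs := smooth_iter_along Ys smooth_harmonic_coord.
have X0 : filt 0 X by apply: filt_mono Xf.
have Y1 : filt (-1) Y by apply: Ysf; rewrite inE eqxx.
have Ysf' V : V \in Ys -> filt (-1) V by move=> VY; apply: Ysf; rewrite inE VY orbT.
have /= := along_commutator hK oO W_unit W_smooth X Y Hs Oq.
rewrite torsion_pl // => E.
have E2 : along Y (along X (iter_along Ys H)) q = 0.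
  apply: etrans (along_cst W Y 0 q); apply: (along_eq oO) => // y Oy.
  by apply: IH => //; apply: (filt_mono hZ _ Xf); rewrite lez_nat.
have E3 : along (br L X Y) (iter_along Ys H) q = 0.
  apply: IH => //; have := filt_br hZ Xf Y1.
  by rewrite [size _]/= intS addrAC subrr add0r.
by move: E; rewrite E2 E3 subr0.
Qed.

End Functional.

Variable f : g -> g.
Hypothesis f_smooth : smooth_mx O f.
Hypothesis f_sym : forall A q, O q -> along_vec W A f q = - torsion W A (f q) q.

Section Invariance.
Variables (cls : 'End(tensor2 K d)) (ab : 'I_d * 'I_d) (c : 'I_d).
Local Notation H := (harmonic_coord cls ab c).

Lemma symmetry_harmonic_coord q : O q -> along (f q) H q = 0.
Proof.
move=> Oq; have [w wE] := functional_of_form hss cls ab c.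
apply: etrans (along_eq oO W _ Oq (fun y _ => wE (kappa y))) _.
rewrite along_functional // big1 // => i _; rewrite big1 // => j _.
rewrite big1 // => k _.
have ts := smooth_torsion oO W_unit W_smooth (e i) (e j) 0 k.
suff -> : along (f q) (fun y => form (kappa y) (e i) (e j) 0 k) q = 0 by rewrite mulr0.
apply: etrans (_ : along (f q)
  (fun y => br L (e i) (e j) 0 k + - torsion W (e i) (e j) y 0 k) q = _).
  apply: (along_eq oO) => // y Oy; rewrite formE // [LHS]mxE.
  by congr (_ + _); rewrite [LHS]mxE.
apply: etrans (alongD W _ (smooth_cst oO (br L (e i) (e j) 0 k)) (smoothN oO ts) Oq) _.
rewrite along_cst add0r (alongN W _ ts Oq) -along_vecE.
by rewrite (symmetry_torsion hK oO W_unit W_smooth f_smooth f_sym) // mxE oppr0.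
Qed.

(** By [symmetry_commutes], xi may be moved past all D_Y, up to H. *)
Lemma symmetry_iter_along (Ys : seq g) q : O q ->
  along (f q) (foldr (fun Y k => along Y k) H Ys) q = 0.
Proof.
elim: Ys q => [|Y Ys IH] q Oq; first exact: symmetry_harmonic_coord.
have Hs := smooth_iter_along Ys (smooth_harmonic_coord cls ab c).
have E := symmetry_commutes hK oO W_unit W_smooth f_smooth f_sym Y Hs Oq.
apply: etrans E _; apply: etrans (along_cst W Y 0 q).
by apply: (along_eq oO) => // y Oy; exact: IH.
Qed.

End Invariance.

(** Induction on r, replacing X by [X, Y]: the hypothesis on the derivatives of
    order r + 1 along X yields the one on derivatives of order r along [X, Y],
    because D_Y D_X vanishes by [iter_along_vanish].  For r = 0 the hypothesis
    says that X . kappa is in the image of d*, and X may be replaced by its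
    component Xr in g_0, as p_+ acts trivially on homology. *)
Lemma tanaka_of_iterates (cls : 'End(tensor2 K d)) q r X Xr :
  (forall T, boundaries L Z nu T <-> cls T = 0) -> O q ->
  filt r%:Z X -> grade L Z r%:Z Xr -> filt r.+1%:Z (X - Xr) ->
  (forall ab c (Ys : seq g), size Ys = r -> (forall Y, Y \in Ys -> filt (-1) Y) ->
     along X (foldr (fun Y k => along Y k) (harmonic_coord cls ab c) Ys) q = 0) ->
  tanaka_nonneg L Z (ann L Z nu (homology_class L Z nu (kappa q))) r Xr.
Proof.
move=> clsK Oq; elim: r X Xr => [|r IH] X Xr Xf Xg XXr XH /=.
  apply: (ann_of_boundary hZ Xg).
  have BX : boundaries L Z nu (act2 L X (kappa q)).
    apply/clsK/ffunP => ab; apply/rowP => c.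
    have := XH ab c [::] erefl (fun _ => ltac:(done)).
    rewrite along_harmonic_coord // => /eqP; rewrite oppr_eq0 => /eqP ->.
    by rewrite ffunE mxE.
  have -> : Xr = X + - (X - Xr) by rewrite opprB addrC subrK.
  rewrite act2Dl; apply: boundariesD => //.
  have -> : act2 L (- (X - Xr)) (kappa q) = - act2 L (X - Xr) (kappa q).
    apply/eqP; rewrite -addr_eq0 -act2Dl addNr; apply/eqP/ffunP => ij.
    by rewrite !ffunE br0l add0r big1 // => k _; rewrite br0l !mxE !scale0r addr0.
  exact: boundaries_act (kappa_chain Oq) (kappa_normal Oq) XXr.
split => // Y Y1; have Yf : filt (-1) Y by exact: grade_filt Y1.
have shift n (V : g) : filt n.+1%:Z V -> filt n%:Z (br L V Y).
  by move=> Vf; have := filt_br hZ Vf Yf; rewrite intS addrAC subrr add0r.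
apply: (IH (br L X Y)).
- exact: shift.
- by have := grade_br Xg Y1; rewrite intS addrAC subrr add0r.
- by rewrite -brNl -brDl; exact: shift.
move=> ab c Ys sYs Ysf.
have Hs := smooth_iter_along Ys (smooth_harmonic_coord cls ab c).
have X0 : filt 0 X by apply: filt_mono Xf.
have := along_commutator hK oO W_unit W_smooth X Y Hs Oq.
rewrite torsion_pl // => <-.
have -> : along Y (along X (foldr (fun Y k => along Y k) (harmonic_coord cls ab c) Ys)) q = 0.
  apply: etrans (along_cst W Y 0 q); apply: (along_eq oO) => // y Oy.
  by apply: iter_along_vanish => //; rewrite sYs.
rewrite subr0; apply: (XH ab c (Y :: Ys)); first by rewrite /= sYs.
by move=> V; rewrite inE => /orP[/eqP ->|/Ysf].
Qed.

Lemma chart_tanaka q r Xr : O q ->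
  filt r%:Z (f q) -> grade L Z r%:Z Xr -> filt r.+1%:Z (f q - Xr) ->
  tanaka_nonneg L Z (ann L Z nu (homology_class L Z nu (kappa q))) r Xr.
Proof.
move=> Oq fr gr fgr; have [cls clsK] := boundaries_kernel L Z nu.
apply: (tanaka_of_iterates clsK Oq fr gr fgr) => ab c Ys _ _.
exact: symmetry_iter_along.
Qed.

End SymmetryInChart.

(** * Passing to a chart of a manifold *)

Section Transitions.
Variables (K : numFieldType) (n : nat) (M : manifold K n).
Implicit Types x y z : M.

(** The domain, in the chart at x, of the change of coordinates to the chart at
    y. *)
Definition overlap x y : set 'rV[K]_n := chart x @` (source x `&` source y).

Lemma overlapP x y q : overlap x y q <-> image_of x q /\ source y (param x q).
Proof.
split=> [[z [xz yz] <-]|[[z xz <-]]]; first by rewrite chartK //; split => //; exists z.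
by rewrite chartK // => yz; exists z.
Qed.

Lemma image_of_open x : open (image_of x).
Proof. exact: image_open. Qed.

Lemma overlap_open x y : open (overlap x y).
Proof.
rewrite openE => q /overlapP[xq yq].
have qO : nbhs q (image_of x) by apply: open_nbhs_nbhs; split => //; exact: image_open.
have qy : nbhs q (param x @^-1` source y).
  apply: (param_continuous xq); apply: open_nbhs_nbhs; split => //.
  exact: source_open.
rewrite /interior; apply: filterS (filterI qO qy) => r [xr yr].
by apply/overlapP.
Qed.

Lemma image_center x : image_of x (chart x x).
Proof. by exists x => //; exact: source_center. Qed.

Lemma param_center x : param x (chart x x) = x.
Proof. by rewrite chartK //; exact: source_center. Qed.

Lemma overlap_self x y q : image_of x q -> y = param x q -> overlap x y q.
Proof. by move=> xq ->; apply/overlapP; split => //; exact: source_center. Qed.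

Lemma overlap_image x y q : overlap x y q -> image_of x q.
Proof. by move=> /overlapP[]. Qed.

Lemma param_transition x y q : overlap x y q ->
  param y (chart y (param x q)) = param x q.
Proof. by move=> /overlapP[_ yq]; rewrite chartK. Qed.

Lemma transition_overlap x y q : overlap x y q ->
  overlap y x (chart y (param x q)).
Proof.
by move=> [z [xz yz] <-]; exists z => //; rewrite chartK.
Qed.

Lemma overlap_refl x q : image_of x q -> overlap x x q.
Proof. by move=> [z xz <-]; apply/overlapP; split; [exists z|rewrite chartK]. Qed.

Lemma transition_diff x y q : overlap x y q ->
  differentiable (chart y \o param x) q.
Proof. by move=> xyq; exact: (smooth_on_diff (@chart_compatible _ _ M x y)). Qed.

Lemma transition_chain x y z q w : overlap x y q -> overlap x z q ->
  'D_w (chart z \o param x) q =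
  'D_('D_w (chart y \o param x) q) (chart z \o param y) (chart y (param x q)).
Proof.
move=> xyq xzq.
have yzq : overlap y z (chart y (param x q)).
  apply/overlapP; split; first exact: overlap_image (transition_overlap xyq).
  by rewrite param_transition //; have [] := (overlapP x z q).1 xzq.
rewrite -(derive_comp_vec _ (transition_diff xyq) (transition_diff yzq)).
apply: (derive_eq_on (overlap_open (x := x) (y := y)) _ xyq) => r xyr /=.
by rewrite param_transition.
Qed.

Lemma transition_id x q w : image_of x q -> 'D_w (chart x \o param x) q = w.
Proof.
move=> xq; rewrite -[RHS](derive_id q w).
apply: (derive_eq_on (image_of_open (x := x)) _ xq) => r [z xz <-] /=.
by rewrite chartK.
Qed.

End Transitions.

Section FormsInCharts.
Variables (K : numFieldType) (n d : nat) (M : manifold K n).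
Variable omega : M -> {linear 'rV[K]_n -> 'rV[K]_d}.
Local Notation om := (fun u => omega u : 'rV[K]_n -> 'rV[K]_d).
Hypothesis omega_smooth : smooth_form om.
Hypothesis omega_bij : forall u, bijective (omega u).
Implicit Types x y z : M.
Local Notation e j := (delta_mx 0 j : 'rV[K]_n).

Lemma form_linear_comb x q w : image_of x q ->
  form_in_chart x om q w = \sum_j w 0 j *: form_in_chart x om q (e j).
Proof.
move=> xq; rewrite /form_in_chart; set y := param x q.
have td := transition_diff (overlap_self xq (erefl y)).
by rewrite derive_lin_comb // linear_sum; apply: eq_bigr => j _; rewrite linearZ.
Qed.

Lemma form_change x y q w : overlap x y q ->
  form_in_chart x om q w =
  form_in_chart y om (chart y (param x q)) ('D_w (chart y \o param x) q).
Proof.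
move=> xyq; rewrite /form_in_chart param_transition //.
rewrite -transition_chain //.
by apply: overlap_self => //; exact: overlap_image xyq.
Qed.

Lemma form_center y w : form_in_chart y om (chart y y) w = omega y w.
Proof. by rewrite /form_in_chart param_center transition_id //; exact: image_center. Qed.

Lemma form_at x q w : image_of x q ->
  form_in_chart x om q w = omega (param x q) ('D_w (chart (param x q) \o param x) q).
Proof. by []. Qed.

(** X in the chart at x is the image of its coordinates in the chart at y
    under the change of charts from y to x, which the form in the chart at x
    undoes. *)
Lemma form_field x q (X : M -> 'rV[K]_n) : image_of x q ->
  form_in_chart x om q (field_in_chart x X q) = omega (param x q) (X (param x q)).
Proof.
move=> xq; rewrite /form_in_chart /field_in_chart; set y := param x q.
have xyq : overlap x y q by exact: overlap_self.
have qE : q = chart x (param y (chart y y)).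
  by rewrite param_center /y; have [z xz <-] := xq; rewrite chartK.
have yxc : overlap y x (chart y y) by exact: (transition_overlap xyq).
rewrite {1}qE -transition_chain //; last first.
  by apply: overlap_self; rewrite ?param_center //; exact: image_center.
by rewrite transition_id //; exact: image_center.
Qed.

Definition coframe_mx x q : 'M[K]_(n, d) :=
  \matrix_(j, c) form_in_chart x om q (e j) 0 c.

Lemma coframe_mxE x q w : image_of x q ->
  w *m coframe_mx x q = form_in_chart x om q w.
Proof.
move=> xq; rewrite form_linear_comb // mulmx_sum_row; apply: eq_bigr => j _.
by congr (_ *: _); apply/rowP => c; rewrite !mxE.
Qed.

Lemma smooth_coframe x : smooth_mx (image_of x) (coframe_mx x).
Proof.
move=> j c; have oO := image_of_open (x := x).
have := smooth_on_coord c oO (omega_smooth x (e j)).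
by apply: (smooth_eq oO) => q xq; rewrite mxE.
Qed.

Lemma smooth_form_coord x w c :
  smooth (image_of x) (fun q => form_in_chart x om q w 0 c).
Proof. exact: (smooth_on_coord c (image_of_open (x := x)) (omega_smooth x w)). Qed.

Lemma coframe_inj x q (w : 'rV[K]_n) : image_of x q -> w *m coframe_mx x q = 0 -> w = 0.
Proof.
move=> xq; rewrite coframe_mxE //; set y := param x q.
have xyq : overlap x y q by exact: overlap_self.
rewrite form_at // -/y -(linear0 (omega y)) => /(bij_inj (omega_bij y)) D0.
have := transition_chain w xyq (overlap_refl xq).
by rewrite transition_id // D0 derive0.
Qed.

Lemma ext_deriv_coord y v w c :
  ext_deriv om y v w 0 c =
  'D_v (fun q => form_in_chart y om q w 0 c) (chart y y)
  - 'D_w (fun q => form_in_chart y om q v 0 c) (chart y y).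
Proof.
have fd u : differentiable (fun q => form_in_chart y om q u) (chart y y).
  exact: (smooth_on_diff (omega_smooth y u) (image_center y)).
by rewrite /ext_deriv !mxE !derive_coord.
Qed.

Lemma derive_form_comb y v w c q : image_of y q ->
  'D_v (fun q => form_in_chart y om q w 0 c) q =
  \sum_j w 0 j * 'D_v (fun q => form_in_chart y om q (e j) 0 c) q.
Proof.
move=> yq; have oO := image_of_open (x := y).
have E r : image_of y r -> form_in_chart y om r w 0 c =
    (\sum_j (w 0 j \*: (fun q => form_in_chart y om q (e j) 0 c))) r.
  move=> yr; rewrite form_linear_comb // summxE fct_sumE.
  by apply: eq_bigr => j _; rewrite mxE.
rewrite (derive_eq_on oO _ yq E).
have dj j : derivable (fun q => form_in_chart y om q (e j) 0 c) q v.
  exact: (smooth_derivable _ (smooth_form_coord _ _ _) yq).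
rewrite derive_sum; last by move=> j; exact: derivableZ.
by apply: eq_bigr => j _; rewrite deriveZ.
Qed.

Variables (R : realType).
Hypothesis hK : K = R :> numFieldType \/ K = R[i] :> numFieldType.

(** Differentiate the transformation rule of the form omega under the change of
    charts phi, a product rule: the first term has the second derivatives of
    phi, the last one is a derivative in the chart at y. *)
Lemma derive_form_change x y q a b c : overlap x y q ->
  'D_a (fun r => form_in_chart x om r b 0 c) q =
  \sum_j 'D_a ('D_b (fun r => (chart y (param x r)) 0 j)) q
         * form_in_chart y om (chart y (param x q)) (e j) 0 c
  + 'D_('D_a (chart y \o param x) q)
      (fun r => form_in_chart y om r ('D_b (chart y \o param x) q) 0 c)
      (chart y (param x q)).
Proof.
move=> xyq; have oS := overlap_open (x := x) (y := y).
pose phi j r := (chart y (param x r)) 0 j.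
pose F j r := form_in_chart y om r (e j) 0 c.
have phis j : smooth (overlap x y) (phi j).
  exact: (smooth_on_coord j oS (@chart_compatible _ _ M x y)).
have yq' r : overlap x y r -> image_of y (chart y (param x r)).
  by move=> xyr; exact: overlap_image (transition_overlap xyr).
have Fd j r : overlap x y r -> differentiable (F j) (chart y (param x r)).
  by move=> xyr; apply: (smooth_diff (smooth_form_coord _ _ _)); exact: yq'.
have FCd j r : overlap x y r -> differentiable (F j \o (chart y \o param x)) r.
  by move=> xyr; apply: differentiable_comp; [exact: transition_diff|exact: Fd].
have E r : overlap x y r -> form_in_chart x om r b 0 c =
    (\sum_j ('D_b (phi j) * (F j \o (chart y \o param x)))) r.
  move=> xyr; rewrite (form_change _ xyr) form_linear_comb; last exact: yq'.
  rewrite summxE fct_sumE; apply: eq_bigr => j _; rewrite mxE.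
  by rewrite -derive_coord //; exact: transition_diff.
rewrite (derive_eq_on oS _ xyq E).
have pd j : derivable ('D_b (phi j)) q a.
  exact: (smooth_derivable _ (smooth_derive _ (phis j)) xyq).
have cd j : derivable (F j \o (chart y \o param x)) q a.
  by apply: diff_derivable; exact: FCd.
rewrite derive_sum; last by move=> j; exact: derivableM.
rewrite derive_form_comb; last exact: yq'.
rewrite -big_split; apply: eq_bigr => j _ /=.
have C := derive_comp_vec a (transition_diff xyq) (Fd j q xyq).
have B := derive_coord b 0 j (transition_diff xyq).
have alg (s t u v : K) : s * t + u * v = v * u + s * t by ring.
apply: etrans (deriveM (pd j) (cd j)) _; rewrite C -B; exact: alg.
Qed.

(** Naturality of the exterior derivative: the second derivatives of the
    change of charts cancel by symmetry.  This expresses the exterior derivative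
    at all points near x, each of which has a chart of its own, in the single
    chart at x. *)
Lemma ext_deriv_change x q a b c : image_of x q ->
  ext_deriv om (param x q) ('D_a (chart (param x q) \o param x) q)
    ('D_b (chart (param x q) \o param x) q) 0 c =
  'D_a (fun r => form_in_chart x om r b 0 c) q
  - 'D_b (fun r => form_in_chart x om r a 0 c) q.
Proof.
move=> xq; set y := param x q; have xyq : overlap x y q by exact: overlap_self.
rewrite ext_deriv_coord.
apply: etrans (esym (congr2 (fun s t => s - t) (derive_form_change a b c xyq)
  (derive_form_change b a c xyq))).
have oS := overlap_open (x := x) (y := y).
have S : \sum_j 'D_b ('D_a (fun r => (chart y (param x r)) 0 j)) q
           * form_in_chart y om (chart y (param x q)) (e j) 0 c =
         \sum_j 'D_a ('D_b (fun r => (chart y (param x r)) 0 j)) q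
           * form_in_chart y om (chart y (param x q)) (e j) 0 c.
  apply: eq_bigr => j _.
  have phis := smooth_on_coord j oS (@chart_compatible _ _ M x y).
  have D := @smooth_schwarz _ _ _ oS _ hK _ q a b phis xyq.
  exact: (congr1 (fun t => t * form_in_chart y om (chart y (param x q)) (e j) 0 c) D).
have alg (s s' t u : K) : s' = s -> t - u = s + t - (s' + u).
  by move=> ->; ring.
exact: alg S.
Qed.

Lemma smooth_symmetry_coord x (X : M -> 'rV[K]_n) : smooth_field X ->
  smooth_mx (image_of x) (fun q => omega (param x q) (X (param x q))).
Proof.
move=> Xs i c; have oO := image_of_open (x := x).
have : smooth (image_of x) (fun q => \sum_j field_in_chart x X q 0 j *
    form_in_chart x om q (e j) 0 c).
  apply: smooth_sum => // j; apply: smoothM => //; last exact: smooth_form_coord.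
  exact: (smooth_on_coord j oO (Xs x)).
apply: (smooth_eq oO) => q xq; rewrite ord1 -form_field // form_linear_comb //.
by rewrite summxE; apply: eq_bigr => j _; rewrite [RHS]mxE.
Qed.

(** The formula of Cartan: L_X omega = i_X d omega + d (omega (X)). *)
Lemma lie_deriv_coord y (X : M -> 'rV[K]_n) w c : smooth_field X ->
  lie_deriv_form X om y w 0 c =
  ext_deriv om y (X y) w 0 c +
  'D_w (fun q => omega (param y q) (X (param y q)) 0 c) (chart y y).
Proof.
move=> Xs; have oO := image_of_open (x := y); have yc := image_center y.
have Xd : differentiable (field_in_chart y X) (chart y y).
  exact: (smooth_on_diff (Xs y) yc).
have Xj j : derivable (fun q => field_in_chart y X q 0 j) (chart y y) w.
  by apply: diff_derivable; exact: coord_differentiable.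
have Fd u : differentiable (fun q => form_in_chart y om q u) (chart y y).
  exact: (smooth_on_diff (omega_smooth y u) yc).
have Fj j : derivable (fun q => form_in_chart y om q (e j) 0 c) (chart y y) w.
  by apply: diff_derivable; exact: coord_differentiable.
have XE : field_in_chart y X (chart y y) = X y.
  by rewrite /field_in_chart param_center transition_id.
have E q : image_of y q -> omega (param y q) (X (param y q)) 0 c =
    (\sum_j ((fun q => field_in_chart y X q 0 j) *
             (fun q => form_in_chart y om q (e j) 0 c))) q.
  move=> yq; rewrite -form_field // form_linear_comb // summxE fct_sumE.
  by apply: eq_bigr => j _; rewrite mxE.
rewrite (derive_eq_on oO _ yc E) derive_sum; last by move=> j; exact: derivableM.
have D : \sum_j 'D_w ((fun q => field_in_chart y X q 0 j) *
             (fun q => form_in_chart y om q (e j) 0 c)) (chart y y) =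
    'D_w (fun q => form_in_chart y om q (X y) 0 c) (chart y y) +
    omega y ('D_w (field_in_chart y X) (chart y y)) 0 c.
  rewrite -(form_center y) form_linear_comb // derive_form_comb // summxE.
  rewrite -big_split; apply: eq_bigr => j _ /=; rewrite [X in _ = _ + X]mxE.
  apply: etrans (deriveM (Xj j) (Fj j)) _; rewrite XE.
  rewrite (derive_coord w 0 j Xd).
  have alg (s t u v : K) : s * t + u * v = s * t + v * u by ring.
  exact: alg.
rewrite [LHS]mxE D ext_deriv_coord derive_coord //.
by rewrite addrA subrK.
Qed.

End FormsInCharts.

Section CoframeInChart.
Variables (R : realType) (K : numFieldType).
Hypothesis hK : K = R :> numFieldType \/ K = R[i] :> numFieldType.
Variables (n : nat) (M : manifold K n).
Variable omega : M -> {linear 'rV[K]_n -> 'rV[K]_n}.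
Local Notation om := (fun u => omega u : 'rV[K]_n -> 'rV[K]_n).
Hypothesis omega_smooth : smooth_form om.
Hypothesis omega_bij : forall u, bijective (omega u).
Variable x : M.
Local Notation W := (coframe_mx omega x).

Lemma coframe_unit q : image_of x q -> W q \in unitmx.
Proof.
move=> xq; rewrite -row_free_unit; apply: inj_row_free => w.
exact: coframe_inj.
Qed.

(** The value at param x q of the field D_A, in the coordinates of the chart at
    that point. *)
Definition pushed_frame (A q : 'rV[K]_n) : 'rV[K]_n :=
  'D_(frame W A q) (chart (param x q) \o param x) q.

Lemma omega_pushed_frame A q : image_of x q ->
  omega (param x q) (pushed_frame A q) = A.
Proof.
move=> xq; rewrite -[RHS](frameK coframe_unit A xq) coframe_mxE //.
Qed.

Lemma pushed_frame_omega q v : image_of x q ->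
  pushed_frame (omega (param x q) v) q = v.
Proof.
by move=> xq; apply: (bij_inj (omega_bij (param x q))); rewrite omega_pushed_frame.
Qed.

Lemma along_coframe B q j c : image_of x q ->
  frame_derivative W B (fun y => W y j c) q =
  'D_(frame W B q) (fun r => form_in_chart x om r (delta_mx 0 j) 0 c) q.
Proof.
move=> xq; rewrite alongE; have oO := image_of_open (x := x).
by apply: (derive_eq_on oO _ xq) => y xy; rewrite mxE.
Qed.

Lemma torsion_ext_deriv A B q : image_of x q ->
  torsion W A B q =
  - ext_deriv om (param x q) (pushed_frame A q) (pushed_frame B q).
Proof.
move=> xq; apply/rowP => c; rewrite [RHS]mxE.
have E := ext_deriv_change omega_smooth hK (frame W A q) (frame W B q) c xq.
rewrite E !derive_form_comb // opprB mxE.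
apply: (congr2 (fun s t => s - t)); apply: eq_bigr => j _;
  apply: (congr1 (fun t => _ * t)); exact: along_coframe.
Qed.

(** By [lie_deriv_coord], the vanishing of L_X omega on D_A is an equation for
    the derivative of omega (X) along D_A. *)
Lemma lie_deriv_torsion (X : M -> 'rV[K]_n) : smooth_field X ->
  (forall u w, lie_deriv_form X om u w = 0) ->
  forall A q, image_of x q ->
  along_vec W A (fun q => omega (param x q) (X (param x q))) q =
  - torsion W A (omega (param x q) (X (param x q))) q.
Proof.
move=> Xs X0 A q xq; set y := param x q.
have xyq : overlap x y q by exact: overlap_self.
apply/rowP => c; rewrite along_vecE alongE [RHS]mxE.
have := congr1 (fun v : 'rV_n => v 0 c) (X0 y (pushed_frame A q)).
rewrite lie_deriv_coord // [RHS]mxE => /eqP; rewrite addrC addr_eq0 => /eqP L0.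
have -> : torsion W A (omega y (X y)) q 0 c =
    - torsion W (omega y (X y)) A q 0 c by rewrite !mxE opprB.
rewrite opprK torsion_ext_deriv // pushed_frame_omega // -/y [RHS]mxE -L0.
pose g r := omega (param y r) (X (param y r)) 0 c.
have gs : smooth (image_of y) g by exact: smooth_symmetry_coord.
have gd : differentiable g (chart y (param x q)).
  by apply: (smooth_diff gs); exact: image_center.
apply: etrans (derive_comp_vec (frame W A q) (transition_diff xyq) gd).
have oS := overlap_open (x := x) (y := y).
by apply: (derive_eq_on oS _ xyq) => r xyr; rewrite /g /= param_transition.
Qed.

End CoframeInChart.

Lemma bijective_linear_dim (K : fieldType) n d
    (f : {linear 'rV[K]_n -> 'rV[K]_d}) : bijective f -> n = d.
Proof.
move=> [g fK gK]; pose A := lin1_mx f.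
have fE v : v *m A = f v by rewrite mul_rV_lin1.
have /eqP <- : row_free A.
  apply: inj_row_free => v; rewrite fE -(linear0 f) => /(congr1 g).
  by rewrite !fK.
have /eqP // : row_full A.
apply/row_fullP; exists (\matrix_i g (delta_mx 0 i)).
by apply/row_matrixP => i; rewrite row_mul rowK fE gK row1.
Qed.

Theorem theorem3p3
  (R : realType) (K : numFieldType)
  (hK : K = R :> numFieldType \/ K = R[i] :> numFieldType)
  (d p m N : nat)
  (G : lie_group K d) (L : lie_algebra K d)
  (hL : is_lie_algebra_of G L) (hss : semisimple L)
  (Z : 'rV[K]_d) (nu : nat) (hZ : is_grading_element L Z nu)
  (P : lie_group K p) (iota : P -> G)
  (hP : is_parabolic_subgroup L Z nu iota)
  (hproper : filt L Z nu 0 <> setT)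
  (M : manifold K m) (hM : connected [set: M])
  (T : manifold K N) (pi : T -> M) (act : T -> P -> T)
  (hT : is_principal_bundle pi act)
  (omega : T -> {linear 'rV[K]_N -> 'rV[K]_d})
  (homega : is_cartan_connection iota act omega)
  (kappa : T -> tensor2 K d)
  (hkappa : is_curvature_function L Z nu omega kappa)
  (hreg : is_regular L Z nu kappa)
  (hnorm : is_normal L kappa)
  (u : T) :
  gr L Z nu (symmetries_at act omega u)
  `<=` tanaka L Z nu (ann L Z nu (harmonic_curvature L Z nu kappa u)).
Proof.
(* each omega_u is an isomorphism of T_u onto g *)
have Nd : N = d by exact: bijective_linear_dim (cartan_iso homega u).
subst N.
have osm := cartan_smooth homega; have obij := cartan_iso homega.
move=> _ [X [XV ->]]; exists X; split => // k; move: (_ - _) (X k) (XV k) => j V.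
(* in negative degrees the prolongation is all of g_- *)
case: j => [r|r] [Vg [_ [[xi [xis _ xi0] <-] Yf YV]]] //=.
have uc := image_center u; have pc := param_center u.
have kt A B q : image_of u q -> torsion (coframe_mx omega u) A B q =
    br L A B - form_of_chain L (kappa (param u q)) A B.
  move=> uq; have [_ /(_ (pushed_frame omega u A q) (pushed_frame omega u B q))] :=
    hkappa (param u q).
  rewrite /curvature !omega_pushed_frame // => ->.
  by rewrite opprD addrCA subrr addr0 (torsion_ext_deriv hK).
have := @chart_tanaka R K hK d _ (image_of_open (x := u)) (coframe_mx omega u)
  (@coframe_unit _ _ _ _ obij u) (smooth_coframe osm u) L Z nu hss hZ
  (fun q => kappa (param u q)) (fun q _ => (hkappa (param u q)).1) kt
  (fun q _ => hnorm (param u q)) _ (smooth_symmetry_coord osm u xis)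
  (lie_deriv_torsion hK osm obij xis xi0) (chart u u) r V uc.
rewrite pc; apply => //.
by move: YV; rewrite /= -PoszD addn1.
Qed.
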